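(* Let $\{(y^t,x^t,u^t,z^t)\}$ be a sequence generated by the STAM algorithm (described in the context) for the problem $\min_{x,y} F(x)+G(y)+H(x,y)$. Suppose that the stochastic gradient $\tilde\nabla G$ satisfies the Expected Smoothness assumption and that $G,H$ satisfy the smoothness assumptions (a1)–(a3), all stated in the context. Define $$\mathcal K_1:=\frac{1-(10(l+L_2^* )+4)\gamma-5(L_2^* )^2\gamma^2}{4\gamma},\qquad \mathcal K_2:=\frac{5(1+\gamma L_2^* )^2}{4\gamma^2},$$ $$\mathcal K_3:=L_4^*(1+5\gamma L_4^* )+\frac{5\mathcal K_1(L_4^* )^2}{\mathcal K_2},\qquad M:=2\mathcal K_3 .$$ Suppose that the parameter $\gamma>0$ is chosen such that $\mathcal K_1>0$ and $\left[(L_2^* )^2+(L_5^* )^2\right]\gamma^2\le1$ hold. Given $\epsilon>0$, choose the parameter $$\beta>\max\Big\{\sqrt{(L+M)AT},\ \frac{2\mathcal K_2}{\mathcal K_1},\ \frac{2(L+M)C}{\epsilon^2}\Big\}.$$ If $$T\ \ge\ \frac{12(L+M)(\delta_0+\mathcal M_0')}{\epsilon^2}\max\Big\{\frac{2C}{\epsilon^2},\ \frac{12(\delta_0+\mathcal M_0')A}{\epsilon^2},\ \frac{2\mathcal K_2}{\mathcal K_1(L+M)}\Big\}=\mathcal O(\epsilon^{-4}),$$ then there exists $0\le t_0\le T-1$ such that $$\mathbb E\|\nabla G(y^{t_0})+\nabla_yH(u^{t_0},y^{t_0})\|\le\epsilon\quad\text{and}\quad \mathbb E\,\mathrm{dist}\big(0,\nabla_xH(u^{t_0},y^{t_0})+\partial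 F(u^{t_0})\big)\le\epsilon .$$
   Context: Functions. $F,G,H$ are proper lower semicontinuous functions, not necessarily convex; $F$ and $G$ are functions of $x\in\mathbb R^n$ and $y\in\mathbb R^n$ respectively, $H$ is a function of $(x,y)$, and $G,H$ have the gradients appearing below. $\partial F$ is the (limiting) subdifferential, and $\mathrm{dist}(0,S)=\inf_{s\in S}\|s\|$. Write $G^{\inf}=\inf_yG(y)$, $H^{\inf}=\inf_{x,y}H(x,y)$, $(G+H)^{\inf}=\inf_{x,y}(G(y)+H(x,y))$. Smoothness assumptions. (a1) $G$ is bounded from below and $\nabla G$ is Lipschitz continuous with constant $L_1>0$. (a2) There exist $L_2(y),L_3(x),L_4(x),L_5(y)>0$ such that for all arguments in $\mathbb R^n$ $\|\nabla_xH(x_1,y)-\nabla_xH(x_2,y)\|\le L_2(y)\|x_1-x_2\|$, $\|\nabla_xH(x,y_1)-\nabla_xH(x,y_2)\|\le L_4(x)\|y_1-y_2\|$, $\|\nabla_yH(x,y_1)-\nabla_yH(x,y_2)\|\le L_3(x)\|y_1-y_2\|$, $\|\nabla_yH(x_1,y)-\nabla_yH(x_2,y)\|\le L_5(y)\|x_1-x_2\|$. (a3) There exist $L_2^*,L_3^*,L_4^*,L_5^*\ge 0$ and $L>0$ with $\sup_yL_2(y)\le L_2^*$, $\sup_xL_3(x)\le L_3^*$, $\sup_xL_4(x)\le L_4^*$, $\sup_yL_5(y)\le L_5^*$ and $L_3^*+L_1\le L$. In addition, $l\in\mathbb R$ is such that $H(\cdot,y)+\frac l2\|\cdot\|^2$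 is convex for all $y\in\mathbb R^n$ (such $l$ always exists, e.g. $l=L_2^*$). Stochastic gradient. The gradient estimator $\tilde\nabla G(y)$ is unbiased, $\mathbb E[\tilde\nabla G(y)]=\nabla G(y)$. Expected Smoothness: for some $A_0,B_0,C_0\ge0$, $\mathbb E[\|\tilde\nabla G(y)\|^2]\le 2A_0(G(y)-G^{\inf})+B_0\|\nabla G(y)\|^2+C_0$ for all $y\in\mathbb R^n$. STAM algorithm. Choose parameters $\gamma,\beta>0$ and an initial point $x^0,y^0$ (the other starting values are not specified further). For $t=0,\dots,T-1$: $y^{t+1}\in\arg\min_y\{\langle\tilde\nabla G(y^t)+\nabla_yH(x^t,y^t),y-y^t\rangle+\frac\beta2\|y-y^t\|^2\}$, $x^{t+1}\in\arg\min_x\{H(x,y^{t+1})+\frac1{2\gamma}\|x-z^t\|^2\}$, $u^{t+1}\in\arg\min_u\{F(u)+\frac1{2\gamma}\|2x^{t+1}-z^t-u\|^2\}$, $z^{t+1}=z^t+(u^{t+1}-x^{t+1})$. Constants. $A=\max(2A_0+2B_0L_1,\,2L_3^* )$, $C=2A[(G+H)^{\inf}-G^{\inf}-H^{\inf}]+2C_0$; $\delta_t=\mathbb E[G(y^t)+H(x^t,y^t)-(G+H)^{\inf}]$; $\mathcal M_0'=\mathbb E[\mathcal M_0-\inf_{t\ge0}\mathcal M_t]$, where $\mathcal M_t=F(u^t)+\frac1{2\gamma}\|2x^t-u^t-z^t\|^2-\frac1{2\gamma}\|x^t-z^t\|^2-\frac1\gamma\|u^t-x^t\|^2$.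
   Formalization: β is taken in some interval (max, β_max] just above the stated max, since arbitrarily large β makes the claim false; u^0, z^0 are not arbitrary: (x^0,u^0,z^0) satisfy the x,u,z updates for some z^{-1}; H is assumed bounded below and T≥1. *)

(* Defs.v *)
(* MathComp-Analysis, over an arbitrary R : realType.  Points of R^n are row
   vectors 'rV[R]_n; extended-real quantities live in \bar R. *)
Set Warnings "-notation-overridden,-notation-incompatible-prefix".
From HB Require Import structures.
From mathcomp Require Export all_boot all_order all_algebra.
From mathcomp Require Export all_classical all_reals all_analysis.

Set Implicit Arguments.
Unset Strict Implicit.
Unset Printing Implicit Defensive.

Export Order.TTheory GRing.Theory Num.Theory.
Export numFieldNormedType.Exports.


Local Open Scope classical_set_scope.
Local Open Scope ring_scope.

(* The library norm on matrices is the sup norm, hence the explicit Euclidean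
   structure; both norms induce the same topology. *)
Definition dot {R : realType} {n : nat} (u v : 'rV[R]_n) : R :=
  \sum_(i < n) u 0 i * v 0 i.

Definition norm2 {R : realType} {n : nat} (u : 'rV[R]_n) : R :=
  Num.sqrt (dot u u).

Definition grad {R : realType} {n : nat} (f : 'rV[R]_n -> R) (x : 'rV[R]_n) :
  'rV[R]_n := \row_(i < n) 'D_(delta_mx 0 i) f x.

Definition gradx {R : realType} {n : nat} (H : 'rV[R]_n -> 'rV[R]_n -> R)
  (x y : 'rV[R]_n) : 'rV[R]_n := grad (fun x' => H x' y) x.

Definition grady {R : realType} {n : nat} (H : 'rV[R]_n -> 'rV[R]_n -> R)
  (x y : 'rV[R]_n) : 'rV[R]_n := grad (fun y' => H x y') y.

Definition proper {R : realType} {T : Type} (f : T -> \bar R) : Prop :=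
  (forall x, f x != -oo%E) /\ (exists x, f x \is a fin_num).

Definition is_argmin {d : Order.disp_t} {K : porderType d} {T : Type}
  (f : T -> K) (x : T) : Prop := forall x', (f x <= f x')%O.

(** Nonsmooth analysis *)

Definition frechet_subdiff {R : realType} {n : nat} (f : 'rV[R]_n -> \bar R)
  (x : 'rV[R]_n) : set 'rV[R]_n :=
  [set v | f x \is a fin_num /\
    (0 <= limf_einf (fun x' : 'rV[R]_n =>
            (f x' - f x - (dot v (x' - x))%:E) * ((norm2 (x' - x))^-1)%:E)
          x^')%E].

Definition limiting_subdiff {R : realType} {n : nat} (f : 'rV[R]_n -> \bar R)
  (x : 'rV[R]_n) : set 'rV[R]_n :=
  [set v | f x \is a fin_num /\
    exists xs vs : nat -> 'rV[R]_n,
      [/\ xs k @[k --> \oo] --> x,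
          f (xs k) @[k --> \oo] --> f x,
          (forall k, frechet_subdiff f (xs k) (vs k)) &
          vs k @[k --> \oo] --> v]].

(* +oo on the empty set *)
Definition dist0 {R : realType} {n : nat} (S : set 'rV[R]_n) : \bar R :=
  ereal_inf [set (norm2 s)%:E | s in S].

(** Smoothness assumptions *)

Definition assumption_a1 {R : realType} {n : nat} (G : 'rV[R]_n -> R)
  (L1 : R) : Prop :=
  [/\ has_lbound (range G),
      (forall y, differentiable G y),
      0 < L1 &
      forall y1 y2, norm2 (grad G y1 - grad G y2) <= L1 * norm2 (y1 - y2)].

Definition assumption_a2 {R : realType} {n : nat}
  (H : 'rV[R]_n -> 'rV[R]_n -> R) (L2 L3 L4 L5 : 'rV[R]_n -> R) : Prop :=
  [/\ (forall x y, differentiable (fun x' => H x' y) x),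
      (forall x y, differentiable (fun y' => H x y') y),
      (forall v, [/\ 0 < L2 v, 0 < L3 v, 0 < L4 v & 0 < L5 v]) &
      [/\ forall x1 x2 y,
            norm2 (gradx H x1 y - gradx H x2 y) <= L2 y * norm2 (x1 - x2),
          forall x y1 y2,
            norm2 (gradx H x y1 - gradx H x y2) <= L4 x * norm2 (y1 - y2),
          forall x y1 y2,
            norm2 (grady H x y1 - grady H x y2) <= L3 x * norm2 (y1 - y2) &
          forall x1 x2 y,
            norm2 (grady H x1 y - grady H x2 y) <= L5 y * norm2 (x1 - x2)]].

Definition assumption_a3 {R : realType} {n : nat}
  (H : 'rV[R]_n -> 'rV[R]_n -> R) (L1 : R) (L2 L3 L4 L5 : 'rV[R]_n -> R)
  (L2s L3s L4s L5s L l : R) : Prop :=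
  [/\ [/\ 0 <= L2s, 0 <= L3s, 0 <= L4s & 0 <= L5s],
      [/\ (ereal_sup (range (fun y => (L2 y)%:E)) <= L2s%:E)%E,
          (ereal_sup (range (fun x => (L3 x)%:E)) <= L3s%:E)%E,
          (ereal_sup (range (fun x => (L4 x)%:E)) <= L4s%:E)%E &
          (ereal_sup (range (fun y => (L5 y)%:E)) <= L5s%:E)%E],
      0 < L /\ L3s + L1 <= L &
      forall y, convex_function setT
        (fun x : 'rV[R]_n => H x y + l / 2 * norm2 x ^+ 2)].

(** Stochastic gradient oracle *)

(* 'rV[R]_n carries no measurable structure in the library: we use its Borel
   sigma-algebra. *)
Notation borel_rV R n := (g_sigma_algebraType (@open 'rV[R]_n)).

(* The estimator at y is g y xi, with xi drawn from the distribution D. *)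
Definition unbiased {R : realType} {n : nat} {dXi : measure_display}
  {Xi : measurableType dXi} (D : probability Xi R)
  (G : 'rV[R]_n -> R) (g : 'rV[R]_n -> Xi -> 'rV[R]_n) : Prop :=
  forall y i, ('E_D[(fun xi => g y xi 0 i)%R] = (grad G y 0 i)%:E)%E.

Definition expected_smoothness {R : realType} {n : nat} {dXi : measure_display}
  {Xi : measurableType dXi} (D : probability Xi R)
  (G : 'rV[R]_n -> R) (g : 'rV[R]_n -> Xi -> 'rV[R]_n) (A0 B0 C0 : R) : Prop :=
  [/\ 0 <= A0, 0 <= B0, 0 <= C0 &
      forall y, ('E_D[fun xi => (norm2 (g y xi) ^+ 2)%R] <=
        (2 * A0 * (G y - inf (range G)) + B0 * norm2 (grad G y) ^+ 2 + C0)%:E)%E].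

(** The STAM algorithm *)

Section Stam.
Context {R : realType} {n : nat}.
Notation V := 'rV[R]_n.

Definition y_update (H : V -> V -> R) (beta : R) (gt x y y' : V) : Prop :=
  is_argmin (fun v => dot (gt + grady H x y) (v - y)
                      + beta / 2 * norm2 (v - y) ^+ 2) y'.

Definition xuz_update (F : V -> \bar R) (H : V -> V -> R) (gamma : R)
  (y' z x' u' z' : V) : Prop :=
  [/\ is_argmin (fun v => H v y' + (2 * gamma)^-1 * norm2 (v - z) ^+ 2) x',
      is_argmin (fun v =>
        (F v + ((2 * gamma)^-1 * norm2 (2 *: x' - z - v) ^+ 2)%:E)%E) u' &
      z' = z + (u' - x')].

(* The information available before the t-th sample is drawn. *)
Definition history {Omega : Type} (y x u z : nat -> Omega -> V) (t : nat) :
  set (set Omega) :=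
  let events (f : Omega -> V) :=
    preimage_set_system setT f (@measurable _ (borel_rV R n)) in
  <<s \bigcup_(s in [set s | (s <= t)%N])
        (events (y s) `|` events (x s) `|` events (u s) `|` events (z s)) >>.

(* y, x, u, z is a run of T iterations driven by the samples xi_0, xi_1, ...:
   xi_t has law D and is independent of the iterates up to time t.  The values
   (x^0, u^0, z^0) are tied to the initial point (x^0, y^0) by the same updates
   as all later ones: equivalently, the run is preceded by an unused z^{-1}
   which produces x^0.  With u^0 and z^0 unrelated to (x^0, y^0), nothing would
   control the residuals at t = 0. *)
Definition stam_run {dXi : measure_display} {Xi : measurableType dXi}
  (F : V -> \bar R) (H : V -> V -> R)
  (D : probability Xi R) (g : V -> Xi -> V) (gamma beta : R) (T : nat)
  {d : measure_display} {Omega : measurableType d} (P : probability Omega R)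
  (xi : nat -> Omega -> Xi) (y x u z : nat -> Omega -> V) : Prop :=
  [/\ forall t,
        [/\ measurable_fun setT (y t : Omega -> borel_rV R n),
            measurable_fun setT (x t : Omega -> borel_rV R n),
            measurable_fun setT (u t : Omega -> borel_rV R n) &
            measurable_fun setT (z t : Omega -> borel_rV R n)],
      forall t, measurable_fun setT (xi t) /\
        (forall B, measurable B -> P (xi t @^-1` B) = D B),
      (forall t, (t < T)%N -> forall A B, history y x u z t A -> measurable B ->
        P (A `&` xi t @^-1` B) = (P A * P (xi t @^-1` B))%E),
      (forall w, exists zprev : V,
        xuz_update F H gamma (y 0%N w) zprev (x 0%N w) (u 0%N w) (z 0%N w)) &
      forall t, (t < T)%N -> forall w,
        y_update H beta (g (y t w) (xi t w)) (x t w) (y t w) (y t.+1 w) /\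
        xuz_update F H gamma (y t.+1 w) (z t w)
          (x t.+1 w) (u t.+1 w) (z t.+1 w)].

Definition merit (F : V -> \bar R) (gamma : R) (x u z : V) : \bar R :=
  (F u + ((2 * gamma)^-1 * norm2 (2 *: x - u - z) ^+ 2
          - (2 * gamma)^-1 * norm2 (x - z) ^+ 2
          - gamma^-1 * norm2 (u - x) ^+ 2)%:E)%E.

Definition infGH (G : V -> R) (H : V -> V -> R) : R :=
  inf (range (fun p : V * V => G p.2 + H p.1 p.2)).

Definition infH (H : V -> V -> R) : R :=
  inf (range (fun p : V * V => H p.1 p.2)).

Definition delta {d : measure_display} {Omega : measurableType d}
  (P : probability Omega R) (G : V -> R) (H : V -> V -> R)
  (y x : nat -> Omega -> V) (t : nat) : \bar R :=
  ('E_P[fun w => (G (y t w) + H (x t w) (y t w) - infGH G H)%R])%E.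

(* Possibly +oo, in which case the lower bound on T cannot hold. *)
Definition merit_gap {d : measure_display} {Omega : measurableType d}
  (P : probability Omega R) (F : V -> \bar R) (gamma : R)
  (x u z : nat -> Omega -> V) : \bar R :=
  (\int[P]_w (merit F gamma (x 0%N w) (u 0%N w) (z 0%N w)
     - ereal_inf (range (fun t => merit F gamma (x t w) (u t w) (z t w)))))%E.

End Stam.

(** Constants *)

Section Constants.
Context {R : realType}.

Definition K1 (l L2s gamma : R) : R :=
  (1 - (10 * (l + L2s) + 4) * gamma - 5 * L2s ^+ 2 * gamma ^+ 2) / (4 * gamma).

Definition K2 (L2s gamma : R) : R :=
  5 * (1 + gamma * L2s) ^+ 2 / (4 * gamma ^+ 2).

Definition K3 (l L2s L4s gamma : R) : R :=
  L4s * (1 + 5 * gamma * L4s)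
  + 5 * K1 l L2s gamma * L4s ^+ 2 / K2 L2s gamma.

Definition constM (l L2s L4s gamma : R) : R := 2 * K3 l L2s L4s gamma.

Definition constA (A0 B0 L1 L3s : R) : R :=
  Num.max (2 * A0 + 2 * B0 * L1) (2 * L3s).

Definition constC {n : nat} (G : 'rV[R]_n -> R) (H : 'rV[R]_n -> 'rV[R]_n -> R)
  (A C0 : R) : R :=
  2 * A * (infGH G H - inf (range G) - infH H) + 2 * C0.

(* Since T_threshold does not depend on beta, beta has to stay close to this
   threshold: for a fixed T, a huge beta freezes the iterates y^t. *)
Definition beta_threshold (k1 k2 L M A C eps : R) (T : nat) : R :=
  Num.max (Num.max (Num.sqrt ((L + M) * A * T%:R)) (2 * k2 / k1))
          (2 * (L + M) * C / eps ^+ 2).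

(* V0 stands for delta_0 + M_0'. *)
Definition T_threshold (k1 k2 L M A C eps : R) (V0 : \bar R) : \bar R :=
  ((12 * (L + M) / eps ^+ 2)%:E * V0 *
   maxe (maxe (2 * C / eps ^+ 2)%:E ((12 / eps ^+ 2)%:E * V0 * A%:E))
        (2 * k2 / (k1 * (L + M)))%:E)%E.

End Constants.

(* Main.v *)
(* As a function of x^t the merit M_t is (2 gamma)^-1 |x^t - z^t|^2 up to a constant,
   so the x-step minimises H(., y^{t+1}) + M_t; by weak convexity one step decreases
   H(., y^{t+1}) + M by a multiple of |x^{t+1} - x^t|^2, up to
   gamma^-1 |u^t - x^{t+1}|^2.
   Since z^t = u^t + gamma gradx H(x^t, y^t) = x^{t+1} + gamma gradx H(x^{t+1}, y^{t+1}),
   both u^t - x^{t+1} and u^t - x^t are controlled by |x^{t+1} - x^t| and |y^{t+1} - y^t|.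
   Together with the descent lemma for the y-step this bounds, pathwise,
     gap_{t+1} + excess_{t+1} + residual_t / (2 beta),
   where gap = G + H - inf (G + H), excess_t = M_t - inf_s M_s, and residual_t is the sum
   of the two squared stationarity measures at (y^t, u^t).  The bound is a nonnegative
   function of the iterates and of the sample xi_t, so by independence and Tonelli it may
   be averaged over xi_t first, and expected smoothness gives
     S_{t+1} + E residual_t / (2 beta) <= (1 + Q) S_t + c,   S_t = E gap_t + E excess_t,
   with Q T <= 1 and c <= eps^2 / (4 beta).  If every E residual_t exceeded eps^2, then
   T eps^2 <= 4 beta (1 + Q)^T S_0; as (1 + Q)^T <= (8/7)^8 < 3, this contradicts the lower
   bound on T as soon as beta is at most 1.03 times its threshold. *)
Require Import Defs.
From HB Require Import structures.
From mathcomp Require Import ring lra measurable_realfun.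

Set Implicit Arguments.
Unset Strict Implicit.
Unset Printing Implicit Defensive.

Local Open Scope classical_set_scope.
Local Open Scope ring_scope.

(** * Euclidean structure and smooth functions *)

Section Euclidean.
Context {R : realType} {n : nat}.
Implicit Types (u v w : 'rV[R]_n) (c : R).

Lemma dotC u v : dot u v = dot v u.
Proof. by apply: eq_bigr => i _; rewrite mulrC. Qed.

Lemma dotDl u v w : dot (u + v) w = dot u w + dot v w.
Proof. by rewrite -big_split; apply: eq_bigr => i _; rewrite /= mxE mulrDl. Qed.

Lemma dotZl c u v : dot (c *: u) v = c * dot u v.
Proof. by rewrite mulr_sumr; apply: eq_bigr => i _; rewrite mxE mulrA. Qed.

Lemma dotNl u v : dot (- u) v = - dot u v.
Proof. by rewrite -scaleN1r dotZl mulN1r. Qed.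

Lemma dotDr u v w : dot u (v + w) = dot u v + dot u w.
Proof. by rewrite dotC dotDl !(dotC _ u). Qed.

Lemma dotZr c u v : dot u (c *: v) = c * dot u v.
Proof. by rewrite dotC dotZl dotC. Qed.

Lemma dotNr u v : dot u (- v) = - dot u v.
Proof. by rewrite dotC dotNl dotC. Qed.

Definition dotE := (dotDl, dotDr, dotNl, dotNr, dotZl, dotZr).

Lemma dot_ge0 u : 0 <= dot u u.
Proof. by apply: sumr_ge0 => i _; rewrite -expr2 sqr_ge0. Qed.

Lemma norm2_ge0 u : 0 <= norm2 u. Proof. exact: sqrtr_ge0. Qed.

Lemma sqr_norm2 u : norm2 u ^+ 2 = dot u u.
Proof. by rewrite sqr_sqrtr ?dot_ge0. Qed.

Lemma dot_eq0 u : dot u u = 0 -> u = 0.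
Proof.
move=> /eqP; rewrite psumr_eq0; last by move=> i _; rewrite -expr2 sqr_ge0.
move=> /allP u0; apply/rowP => i; rewrite mxE.
by have /(_ (mem_index_enum i)) := u0 i; rewrite -expr2 sqrf_eq0 => /eqP.
Qed.

Lemma norm2N u : norm2 (- u) = norm2 u.
Proof. by rewrite /norm2 dotNl dotNr opprK. Qed.

Lemma norm2B u v : norm2 (u - v) = norm2 (v - u).
Proof. by rewrite -norm2N opprB. Qed.

Lemma norm2Z c u : norm2 (c *: u) = `|c| * norm2 u.
Proof. by rewrite /norm2 !dotE mulrA -expr2 sqrtrM ?sqr_ge0// sqrtr_sqr. Qed.

Lemma dot_le_norm2 u v : dot u v <= norm2 u * norm2 v.
Proof.
have [nv0|nv0] := eqVneq (norm2 v) 0.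
  have -> : v = 0 by apply: dot_eq0; rewrite -sqr_norm2 nv0 expr0n.
  by rewrite -(scale0r 0) dotZr mul0r mulr_ge0// norm2_ge0.
have [nu0|nu0] := eqVneq (norm2 u) 0.
  have -> : u = 0 by apply: dot_eq0; rewrite -sqr_norm2 nu0 expr0n.
  by rewrite -(scale0r 0) dotZl mul0r mulr_ge0// norm2_ge0.
have pu : 0 < norm2 u by rewrite lt_neqAle eq_sym nu0 norm2_ge0.
have pv : 0 < norm2 v by rewrite lt_neqAle eq_sym nv0 norm2_ge0.
(* Expanded, this is Cauchy-Schwarz times [2 * norm2 u * norm2 v], hence the separate null cases. *)
have := dot_ge0 (norm2 v *: u - norm2 u *: v).
rewrite !dotE -!sqr_norm2 (dotC v u) => h.
have : 0 <= (norm2 u * norm2 v) * (norm2 u * norm2 v - dot u v) by nra.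
by rewrite pmulr_rge0 ?mulr_gt0// subr_ge0.
Qed.

Lemma norm2D u v : norm2 (u + v) <= norm2 u + norm2 v.
Proof.
rewrite -(@ler_pXn2r _ 2)// ?nnegrE ?addr_ge0 ?norm2_ge0//.
have := dot_le_norm2 u v.
rewrite sqrrD !sqr_norm2 !dotE (dotC v u); lra.
Qed.

Lemma sqr_norm2D_le u v :
  norm2 (u + v) ^+ 2 <= 2 * norm2 u ^+ 2 + 2 * norm2 v ^+ 2.
Proof.
have := dot_ge0 (u - v); rewrite !sqr_norm2 !dotE (dotC v u); lra.
Qed.

End Euclidean.

(** * Descent lemma, proximal optimality and weak convexity *)

Section Smooth.
Context {R : realType} {n : nat}.
Implicit Types (f : 'rV[R]_n -> R) (x y v : 'rV[R]_n).

Lemma derive_grad f x v : differentiable f x -> 'D_v f x = dot (grad f x) v.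
Proof.
move=> df; rewrite deriveE// {1}(row_sum_delta v) linear_sum /=.
apply: eq_bigr => i _; rewrite linearZ /= mxE deriveE//.
by rewrite mulrC.
Qed.

Lemma is_derive_line f x v (s : R) : differentiable f (x + s *: v) ->
  is_derive s 1 (fun t : R => f (x + t *: v)) (dot (grad f (x + s *: v)) v).
Proof.
move=> df; rewrite -derive_grad//.
have E : (fun h : R => h^-1 *: (((fun t : R => f (x + t *: v)) \o shift s) (h *: 1)
   - f (x + s *: v))) = 
    (fun h => h^-1 *: ((f \o shift (x + s *: v)) (h *: v) - f (x + s *: v))).
  apply/funext => h /=; congr (_ *: (f _ - _)).
  by rewrite scalerDl addrCA /GRing.scale /= mulr1.
have dv : derivable f (x + s *: v) v by exact: diff_derivable.
apply: DeriveDef; first by rewrite /derivable E.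
by rewrite /derive E.
Qed.

Lemma is_derive_sub_quad (h : R -> R) (dh a b s : R) : is_derive s (1 : R) h dh ->
  is_derive s (1 : R) (fun t => h t - t * a - t ^+ 2 * b) (dh - a - 2 * s * b).
Proof.
move=> dhP; apply: is_derive_eq; rewrite /GRing.scale /= !mulr1.
by transitivity (dh - (s * 0 + a) - (s ^+ 2 * 0 + b * (s + s))); [|ring].
Qed.

(** The mean value theorem is applied to the Taylor error minus the quadratic term: by
    Cauchy-Schwarz and the Lipschitz bound its derivative along the segment is nonpositive. *)
Lemma descent f (L : R) : (forall x, differentiable f x) ->
  (forall x y, norm2 (grad f x - grad f y) <= L * norm2 (x - y)) ->
  forall x v, f (x + v) <= f x + dot (grad f x) v + L / 2 * norm2 v ^+ 2.
Proof.
move=> df lip x v.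
pose phi (s : R) := f (x + s *: v) - s * dot (grad f x) v
                    - s ^+ 2 * (L / 2 * norm2 v ^+ 2).
pose dphi (s : R) := dot (grad f (x + s *: v)) v - dot (grad f x) v
                    - 2 * s * (L / 2 * norm2 v ^+ 2).
have dphiP (s : R) : is_derive s (1 : R) phi (dphi s).
  have d1 := @is_derive_line f x v s (df _).
  exact: is_derive_sub_quad.
have cphi : {within `[(0 : R), 1], continuous phi}.
  by apply: derivable_within_continuous => s _; have [] := dphiP s.
have [s s01 phiE] := MVT ltr01 (fun s _ => dphiP s) cphi.
suff : phi 1 - phi 0 <= 0.
  by rewrite /phi scale1r scale0r addr0 expr1n expr0n /= mul1r !mul0r; lra.
rewrite phiE subr0 mulr1 /dphi -dotNl -dotDl.
move: s01; rewrite in_itv/= => /andP[s0 s1].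
have := le_trans (dot_le_norm2 _ v)
  (ler_wpM2r (norm2_ge0 v) (lip (x + s *: v) x)).
rewrite [x + _]addrC addrK norm2Z gtr0_norm//; lra.
Qed.

(* Testing the descent lemma at x - grad f x / L *)
Lemma sqr_grad_le f (L m : R) : 0 < L -> (forall x, differentiable f x) ->
  (forall x y, norm2 (grad f x - grad f y) <= L * norm2 (x - y)) ->
  (forall x, m <= f x) ->
  forall x, norm2 (grad f x) ^+ 2 <= 2 * L * (f x - m).
Proof.
move=> L0 df lip mf x.
have := le_trans (mf _) (descent df lip x (- L^-1 *: grad f x)).
rewrite !sqr_norm2 !dotE => h.
have e : L / 2 * (- L^-1 * (- L^-1 * dot (grad f x) (grad f x))) =
  dot (grad f x) (grad f x) / L / 2 by field; exact: lt0r_neq0.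
have {h} : dot (grad f x) (grad f x) / L / 2 <= f x - m by lra.
rewrite -mulrA -invfM ler_pdivrMr ?mulr_gt0// => h; lra.
Qed.

(** First-order optimality by a gradient step: the objective has gradient [p] at [x], and the
    descent lemma would make it strictly smaller at [x - s *: p] unless [p = 0]. *)
Lemma argmin_grad0 f (c L : R) x z : 0 < c -> 0 <= L ->
  (forall x, differentiable f x) ->
  (forall x y, norm2 (grad f x - grad f y) <= L * norm2 (x - y)) ->
  is_argmin (fun v => f v + (2 * c)^-1 * norm2 (v - z) ^+ 2) x ->
  z = x + c *: grad f x.
Proof.
move=> c0 L0 df lip xmin.
have [q qE] : exists q, q = x - z by exists (x - z).
have [p pE] : exists p, p = grad f x + c^-1 *: q by eexists.
have p0 : p = 0.
  apply/dot_eq0/le_anti; rewrite dot_ge0 andbT.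
  (* Along [- p] the objective changes by at most [(k * s ^+ 2 - s) * dot p p], which is least at
     [s = 1 / (2 k)]. *)
  pose k := L / 2 + (2 * c)^-1; have k0 : 0 < k.
    by rewrite ltr_wpDl ?divr_ge0// invr_gt0 mulr_gt0.
  pose s := (2 * k)^-1; have s0 : 0 < s by rewrite invr_gt0 mulr_gt0.
  have ks : k * s = 1 / 2 by rewrite /s; field; exact: lt0r_neq0.
  have h : f x + (2 * c)^-1 * dot q q <=
      f x - s * dot (grad f x) p + L / 2 * (s * (s * dot p p))
      + (2 * c)^-1 * (dot q q - 2 * s * dot q p
                      + s * (s * dot p p)).
    rewrite -(sqr_norm2 q) {1}qE; apply: le_trans (xmin (x + - s *: p)) _.
    apply: lerD.
      by apply: le_trans (descent df lip x _) _; rewrite sqr_norm2 !dotE; lra.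
    rewrite (_ : x + - s *: p - z = q + - s *: p); last first.
      by rewrite qE addrAC.
    rewrite !sqr_norm2 !dotE (dotC p q); lra.
  have e : dot p p = dot (grad f x) p + 2 * (2 * c)^-1 * dot q p.
    by rewrite {1}pE dotDl dotZl; congr (_ + _ * _); field; exact: lt0r_neq0.
  have : s * (dot p p * (1 - k * s)) <= 0 by rewrite /k; nra.
  by rewrite ks pmulr_rle0// => ?; lra.
have /eqP : c *: p = 0 by rewrite p0 scaler0.
rewrite pE qE scalerDr scalerA divff ?lt0r_neq0// scale1r addrA subr_eq0.
by move=> /eqP <-; rewrite addrC.
Qed.

(** The quadratic part of the convexity inequality is exact: [t |x|^2 + (1-t) |y|^2 - |t x + (1-t)
    y|^2 = t (1-t) |x-y|^2]. *)
Lemma convex_chord f (l t : R) x y : 0 <= t <= 1 ->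
  convex_function setT (fun x : 'rV[R]_n => f x + l / 2 * norm2 x ^+ 2) ->
  f (y + t *: (x - y)) <= t * f x + (1 - t) * f y
    + l / 2 * (t * (1 - t) * norm2 (x - y) ^+ 2).
Proof.
move=> /andP[t0 t1] cvx.
have : f (t *: x + (1 - t) *: y)
      + l / 2 * norm2 (t *: x + (1 - t) *: y) ^+ 2 <=
    t * (f x + l / 2 * norm2 x ^+ 2) + (1 - t) * (f y + l / 2 * norm2 y ^+ 2).
  by apply: (cvx (Itv01 t0 t1) x y); rewrite inE.
rewrite (_ : y + t *: (x - y) = t *: x + (1 - t) *: y); last first.
  by rewrite scalerBr scalerBl scale1r addrCA addrA.
rewrite !sqr_norm2 !dotE (dotC y x); lra.
Qed.

(* The second difference of [f] is at least [- l * norm2 v ^+ 2] by convexity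
   and at most [L * norm2 v ^+ 2] by the descent lemma. *)
Lemma convex_lipschitz_ge0 f (L l : R) : (forall x, differentiable f x) ->
  (forall x y, norm2 (grad f x - grad f y) <= L * norm2 (x - y)) ->
  convex_function setT (fun x : 'rV[R]_n => f x + l / 2 * norm2 x ^+ 2) ->
  forall v, 0 <= (l + L) * norm2 v ^+ 2.
Proof.
move=> df lip cvx v.
have h01 : 0 <= (2^-1 : R) <= 1 by lra.
have := convex_chord v (- v) h01 cvx.
have := descent df lip 0 v; have := descent df lip 0 (- v).
have -> : - v + 2^-1 *: (v - - v) = 0.
  rewrite opprK scalerDr -scalerDl (_ : 2^-1 + 2^-1 = 1 :> R); last by lra.
  by rewrite scale1r addNr.
rewrite !add0r !sqr_norm2 !dotE; lra.
Qed.

(** Quadratic growth at the minimiser of an objective with convexity modulus [c^-1 - l], of either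
    sign. Comparing [x'] with [x' + t (x - x')] and dividing by [t] gives [k * (1 - t) <= e]; small
    [t] yields [k <= e]. *)
Lemma argmin_strong f (l c : R) x x' z :
  convex_function setT (fun x : 'rV[R]_n => f x + l / 2 * norm2 x ^+ 2) ->
  is_argmin (fun v => f v + (2 * c)^-1 * norm2 (v - z) ^+ 2) x' ->
  f x' + (2 * c)^-1 * norm2 (x' - z) ^+ 2
    + (c^-1 - l) / 2 * norm2 (x - x') ^+ 2
    <= f x + (2 * c)^-1 * norm2 (x - z) ^+ 2.
Proof.
move=> cvx xmin.
pose k := (c^-1 - l) / 2 * norm2 (x - x') ^+ 2.
pose e := f x + (2 * c)^-1 * norm2 (x - z) ^+ 2
          - (f x' + (2 * c)^-1 * norm2 (x' - z) ^+ 2).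
suff : k <= e by rewrite /k /e; lra.
have ke t : 0 < t <= 1 -> k * (1 - t) <= e.
  move=> /andP[t0 t1]; have t01 : 0 <= t <= 1 by rewrite ltW.
  have := le_trans (xmin (x' + t *: (x - x')))
    (lerD (convex_chord x x' t01 cvx) (lexx _)).
  rewrite -[x' + _ - z]addrA (addrC _ (- z)) addrA.
  have normE (a : R) : norm2 (x' + a *: (x - x') - z) ^+ 2 =
      norm2 (x' - z) ^+ 2 + 2 * a * dot (x' - z) (x - x')
      + a ^+ 2 * norm2 (x - x') ^+ 2.
    rewrite addrAC; move: (x' - z) (x - x') => r q.
    by rewrite !sqr_norm2 !dotE (dotC q r); ring.
  have := normE 1; rewrite scale1r addrC [x' + _]addrC subrK => xz.
  rewrite normE => h.
  rewrite -subr_le0 -(@pmulr_rle0 _ t)//.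
  rewrite /k /e xz invfM; lra.
have e0 : 0 <= e by have := ke 1; rewrite subrr mulr0; apply; rewrite ltr01 lexx.
rewrite leNgt; apply/negP => ek.
have k0 : 0 < k by exact: le_lt_trans ek.
have kV : k * k^-1 = 1 by rewrite divff// lt0r_neq0.
(* If [e < k], this [t] makes [k * (1 - t) = (k + e) / 2 > e]; [0 <= e] keeps [t <= 1]. *)
have := ke ((k - e) / 2 * k^-1).
have h1 : 0 < (k - e) / 2 * k^-1 by rewrite mulr_gt0 ?invr_gt0//; lra.
have h2 : (k - e) / 2 * k^-1 <= 1 by rewrite ler_pdivrMr//; lra.
rewrite h1 h2 => /(_ isT); nra.
Qed.

End Smooth.

(** * Proximal points and subdifferentials *)

Section Subdifferential.
Context {R : realType} {n : nat}.
Implicit Types (F : 'rV[R]_n -> \bar R) (u v p : 'rV[R]_n).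

Lemma norm2_continuous : continuous (norm2 : 'rV[R]_n -> R).
Proof.
move=> u; apply: (@continuous_comp _ _ _ (fun v => dot v v) Num.sqrt);
  last exact: sqrt_continuous.
apply: continuous_big => [|i _ v]; first exact: add_continuous.
have cv := @coord_continuous R 1 n 0 i v.
exact: (cvgM cv cv).
Qed.

Lemma near_norm2_lt u (e : R) : 0 < e -> \forall v \near u, norm2 (v - u) < e.
Proof.
move=> e0; have /cvgr_lt : norm2 (v - u) @[v --> u] --> norm2 (u - u).
  apply: (@continuous_comp _ _ _ (fun v => v - u) norm2); last exact: norm2_continuous.
  exact: (cvgB cvg_id (cvg_cst u)).
apply; rewrite subrr /norm2 /dot big1 ?sqrtr0// => i _.
by rewrite mxE mul0r.
Qed.

Lemma argmin_fin_num F (q : 'rV[R]_n -> R) u : proper F ->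
  is_argmin (fun v => (F v + (q v)%:E)%E) u -> F u \is a fin_num.
Proof.
move=> [FNy [v Fv]] umin; have := umin v; have := FNy u.
by case: (F u) (F v) Fv => [r| |] [s| |].
Qed.

(** Minimality of [u] bounds the Frechet quotient at [v] from below by [- norm2 (v - u) / (2 c)],
    which vanishes as [v] tends to [u]. *)
Lemma prox_frechet F (c : R) p u : proper F -> 0 < c ->
  is_argmin (fun v => (F v + ((2 * c)^-1 * norm2 (p - v) ^+ 2)%:E)%E) u ->
  frechet_subdiff F u (c^-1 *: (p - u)).
Proof.
move=> Fp c0 umin; have Fu := argmin_fin_num Fp umin; split=> //.
rewrite limf_einfE; apply/lee_addgt0Pr => e e0; rewrite -leeBlDr// sub0e.
(* On this punctured ball of Euclidean radius [2 c e] the quotient is at least [- e]. *)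
pose V := [set v | v != u /\ norm2 (v - u) < e * (2 * c)].
apply: le_ereal_sup_tmp; eexists; first exists V; [|reflexivity|].
  apply: filterI; first exact: withinT.
  apply: nbhs_dnbhs.
  by apply: near_norm2_lt; rewrite mulr_gt0// mulr_gt0.
apply: le_ereal_inf_tmp => _ [v [vu vV] <-].
have nv0 : 0 < norm2 (v - u).
  rewrite lt_neqAle norm2_ge0 andbT eq_sym; apply: contra_neq vu => n0.
  by apply/eqP; rewrite -subr_eq0; apply/eqP/dot_eq0; rewrite -sqr_norm2 n0 expr0n.
have := umin v; case: Fp => /(_ v) + _.
case: (F u) (F v) Fu => [r| |]// [s| |]//= _ _.
  rewrite -!EFinD !lee_fin => h.
  rewrite ler_pdivlMr//.
  have vu2 : norm2 (p - v) ^+ 2 =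
      norm2 (p - u) ^+ 2 - 2 * dot (p - u) (v - u) + norm2 (v - u) ^+ 2.
    rewrite -{1}(subrKA u p (- v)) -[u - v]opprB.
    by move: (p - u) (v - u) => a b; rewrite !sqr_norm2 !dotE (dotC b a); ring.
  rewrite vu2 in h.
  have hc : (2 * c)^-1 * (2 * c) = 1 by rewrite mulVf// mulf_neq0// lt0r_neq0.
  have cE : c^-1 = 2 * (2 * c)^-1 by field; exact: lt0r_neq0.
  have h0 : 0 < (2 * c)^-1 by rewrite invr_gt0 mulr_gt0.
  have : (2 * c)^-1 * norm2 (v - u) ^+ 2 <= e * norm2 (v - u).
    rewrite expr2 mulrA ler_pM2r// -(ler_pM2r (_ : 0 < 2 * c)) ?mulr_gt0//.
    by rewrite mulrAC hc mul1r ltW.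
  rewrite dotZl cE; lra.
by rewrite gt0_mulye ?leey// lte_fin invr_gt0.
Qed.

Lemma prox_limiting F (c : R) p u : proper F -> 0 < c ->
  is_argmin (fun v => (F v + ((2 * c)^-1 * norm2 (p - v) ^+ 2)%:E)%E) u ->
  limiting_subdiff F u (c^-1 *: (p - u)).
Proof.
move=> Fp c0 umin; split; first exact: argmin_fin_num umin.
exists (fun=> u), (fun=> c^-1 *: (p - u)).
by split=> [||k|]; [exact: cvg_cst|exact: cvg_cst|exact: prox_frechet|exact: cvg_cst].
Qed.

Lemma dist0_le (S : set 'rV[R]_n) u : S u -> (dist0 S <= (norm2 u)%:E)%E.
Proof. by move=> Su; apply: ereal_inf_lbound; exists u. Qed.

Lemma dist0_ge0 (S : set 'rV[R]_n) : (0 <= dist0 S)%E.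
Proof.
by apply: le_ereal_inf_tmp => _ [s _ <-]; rewrite lee_fin norm2_ge0.
Qed.

End Subdifferential.

(** * Measurability and integration *)

Section Measurability.
Context {R : realType} {n : nat}.
Notation V := 'rV[R]_n.
Notation bV := (borel_rV R n).

Lemma continuous_borel (f : V -> R) :
  continuous f -> measurable_fun setT (f : bV -> R).
Proof.
move=> /continuousP cf; apply: (measurability _ (RGenOpens.measurableE R)).
move=> _ [_ [a [b ->] <-]]; rewrite setTI.
apply: sub_sigma_algebra; exact/cf/interval_open.
Qed.

Lemma lsc_borel (f : V -> \bar R) :
  lower_semicontinuous f -> measurable_fun setT (f : bV -> \bar R).
Proof.
move=> /lower_semicontinuousP lf; apply: (measurability _ (ErealGenOInfty.measurableE R)).
move=> /= _ [_ [a ->]] <-; rewrite setTI preimage_itvoy.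
by apply: sub_sigma_algebra; exact: lf.
Qed.

Lemma coord_borel i : measurable_fun setT (fun v : bV => (v : V) 0 i).
Proof. by apply: continuous_borel; exact: coord_continuous. Qed.

(** Integer coordinates, so that the cells [grid k x = v] are half-open cubes of side [1 / (k + 1)]
    indexed by a countable type. *)
Definition grid (k : nat) (x : V) : 'rV[int]_n :=
  \row_i Num.floor (x 0 i * k.+1%:R).

Definition of_grid (k : nat) (v : 'rV[int]_n) : V :=
  \row_i ((v 0 i)%:~R / k.+1%:R).

Lemma measurable_grid k v : measurable ([set x | grid k x = v] : set bV).
Proof.
rewrite (_ : [set x | _] = \bigcap_i
    ((fun x : bV => (x : V) 0 i * k.+1%:R) @^-1` `[(v 0 i)%:~R, (v 0 i + 1)%:~R[)).
  apply: fin_bigcap_measurable => [|i _]; first exact: finite_finset.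
  rewrite -[_ @^-1` _]setTI; apply: measurable_funM => //; first exact: coord_borel.
apply/seteqP; split=> [x /= <- i _|x /= xv].
  by rewrite /= in_itv/= mxE floor_itv.
apply/rowP => i; rewrite mxE; apply/eqP; rewrite floor_eq.
by have := xv i I; rewrite /= in_itv.
Qed.

Lemma cvg_grid x : of_grid k (grid k x) @[k --> \oo] --> x.
Proof.
apply/cvg_ballP => e e0; near=> k; split=> // i j.
rewrite !ord1 /ball /= !mxE.
have k0 : 0 < k.+1%:R :> R by rewrite ltr0n.
have ke : k.+1%:R^-1 < e by near: k; exact: near_infty_natSinv_lt (PosNum e0).
apply: le_lt_trans ke.
have /andP[h1 h2] := floor_itv (x 0 j * k.+1%:R).
move: (Num.floor _) h1 h2 => m h1 h2.
rewrite (_ : _ - _ = (x 0 j * k.+1%:R - m%:~R) / k.+1%:R); last first.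
  by rewrite mulrBl mulfK ?gt_eqF.
rewrite normrM normfV (gtr0_norm k0) ger0_norm ?subr_ge0//.
rewrite intrD in h2.
by rewrite ler_piMl ?invr_ge0 ?(ltW k0)// lerBlDl ltW.
Unshelve. all: by end_near. Qed.

(* f is the limit of its values at the grid points below x, of which there are
   countably many at each scale. *)
Lemma caratheodory_measurable d (Y : measurableType d) (f : V -> Y -> R) :
  (forall y, continuous (f ^~ y)) -> (forall x, measurable_fun setT (f x)) ->
  measurable_fun setT (fun p : bV * Y => f p.1 p.2).
Proof.
move=> cf mf.
have cvgf (x : V) y : f (of_grid k (grid k x)) y @[k --> \oo] --> f x y.
  by apply: (@continuous_cvg _ _ _ _ _ _ (f ^~ y) x (cf y x)); exact: cvg_grid.
apply: (@measurable_fun_cvg _ _ _ _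
  (fun k (p : bV * Y) => f (of_grid k (grid k p.1)) p.2)); last first.
  by move=> [x y] _; exact: cvgf.
move=> k _ B mB; rewrite setTI.
rewrite (_ : _ @^-1` _ = \bigcup_v ([set x : bV | grid k x = v] `*`
                             (f (of_grid k v) @^-1` B))).
  apply: countable_bigcupT_measurable => [|v]; first exact: countableP.
  apply: measurableX; first exact: measurable_grid.
  by rewrite -[_ @^-1` _]setTI; exact: mf.
apply/seteqP; split=> [[x y] /= Bxy|[x y] [v _ [/= <-]]//].
by exists (grid k x).
Qed.

End Measurability.

(** * Integration against independent samples *)

Section Independence.
Local Open Scope ereal_scope.
Context {R : realType} {d d1 d2 : measure_display}.
Context {Omega : measurableType d} {S : measurableType d1} {Xi : measurableType d2}.
Context (P : probability Omega R) (D : probability Xi R).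
Context {X : Omega -> S} {xi : Omega -> Xi}.
Context (mX : measurable_fun setT X) (mxi : measurable_fun setT xi).
Context (indep : forall A B, measurable A -> measurable B ->
  P (X @^-1` A `&` xi @^-1` B) = P (X @^-1` A) * D B).

Let mX_pack : {mfun Omega >-> S} := HB.pack X (isMeasurableFun.Build _ _ _ _ _ mX).

Let mpair : measurable_fun setT (fun w => (X w, xi w)).
Proof. exact: measurable_fun_pair. Qed.

Let mpair_pack : {mfun Omega >-> (S * Xi)%type} :=
  HB.pack (fun w => (X w, xi w)) (isMeasurableFun.Build _ _ _ _ _ mpair).

(** On rectangles the joint law of [(X, xi)] is the product of the law of [X] and [D], hence
    everywhere by uniqueness of the product measure; Tonelli then integrates over [xi] first. This
    plays the part of conditioning on the history. *)
Lemma integral_indep (f : (S * Xi)%type -> \bar R) : measurable_fun setT f ->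
  (forall p, 0 <= f p) ->
  \int[P]_w f (X w, xi w) = \int[P]_w \int[D]_s f (X w, s).
Proof.
move=> mf f0.
have mF := measurable_fun_fubini_tonelli_F (m2 := D) f mf f0.
transitivity (\int[distribution P mX_pack \x D]_p f p); last first.
  rewrite fubini_tonelli1// ge0_integral_distribution//.
  by move=> s; exact: integral_ge0.
transitivity (\int[distribution P mpair_pack]_p f p).
  by rewrite ge0_integral_distribution.
apply: eq_measure_integral => A mA _; apply/esym.
by apply: product_measure_unique => //.
Qed.

End Independence.

(** * Lower integrals and moment inequalities *)

Section Integrals.
Local Open Scope ereal_scope.
Context {R : realType} {d : measure_display} {T : measurableType d}.

(* No measurability is needed: the library's integral of a nonnegative function
   is a lower integral. *)
Lemma ge0_le_lower_integral (mu : {measure set T -> \bar R}) (f f' : T -> \bar R) :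
  (forall x, 0 <= f x) -> (forall x, f x <= f' x) ->
  \int[mu]_x f x <= \int[mu]_x f' x.
Proof.
move=> f0 ff'; rewrite !ge0_integralTE//; last first.
  by move=> x; exact: le_trans (ff' x).
by apply: le_ereal_sup => _ [h /= hf <-]; exists h => // x; exact: le_trans (ff' x).
Qed.

Lemma ge0_integralD3 (mu : {measure set T -> \bar R}) (f1 f2 f3 : T -> \bar R) :
  (forall x, 0 <= f1 x) -> (forall x, 0 <= f2 x) -> (forall x, 0 <= f3 x) ->
  measurable_fun setT f1 -> measurable_fun setT f2 -> measurable_fun setT f3 ->
  \int[mu]_x (f1 x + f2 x + f3 x) =
  \int[mu]_x f1 x + \int[mu]_x f2 x + \int[mu]_x f3 x.
Proof.
move=> f10 f20 f30 m1 m2 m3; rewrite ge0_integralD//; last 2 first.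
- by move=> x _; exact: adde_ge0.
- exact: emeasurable_funD.
by rewrite ge0_integralD.
Qed.

Lemma measurable_dot n (X Y : T -> 'rV[R]_n) :
  (forall i, measurable_fun setT (fun w => X w ord0 i)) ->
  (forall i, measurable_fun setT (fun w => Y w ord0 i)) ->
  measurable_fun setT (fun w => dot (X w) (Y w)).
Proof.
by move=> mX mY; apply: measurable_sum => i; exact: measurable_funM.
Qed.

Lemma measurable_sqr_norm2 n (X : T -> 'rV[R]_n) :
  (forall i, measurable_fun setT (fun w => X w ord0 i)) ->
  measurable_fun setT (fun w => (norm2 (X w) ^+ 2)%R).
Proof.
move=> mX; under eq_fun do rewrite sqr_norm2.
exact: measurable_dot.
Qed.

(** Linearity of the integral requires integrability, which the finite second moment supplies; the
    hypothesis on the means only states values of integrals. *)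
Lemma integral_quadratic_le n (D : probability T R) (Z : T -> 'rV[R]_n)
    (m a : 'rV[R]_n) (c k K : R) :
  (forall i, measurable_fun setT (fun s => Z s ord0 i)) ->
  (forall i, \int[D]_s (Z s ord0 i)%:E = (m ord0 i)%:E) ->
  \int[D]_s (norm2 (Z s) ^+ 2)%:E <= K%:E -> (0 <= k)%R ->
  \int[D]_s (c + dot a (Z s) + k * norm2 (Z s) ^+ 2)%:E
    <= (c + dot a m + k * K)%:E.
Proof.
move=> mZ EZ EZ2 k0.
have mZ2 := measurable_sqr_norm2 mZ.
have iZ2 : D.-integrable setT (fun s => (norm2 (Z s) ^+ 2)%:E).
  apply/integrableP; split; first exact/measurable_EFinP.
  under eq_integral do rewrite gee0_abs ?lee_fin ?sqr_ge0//.
  by apply: le_lt_trans EZ2 _; exact: ltry.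
have ic (r : R) : D.-integrable setT (cst r%:E).
  exact: finite_measure_integrable_cst.
have iZ i : D.-integrable setT (fun s => (Z s ord0 i)%:E).
  apply: le_integrable (integrableD measurableT (ic 1%R) iZ2) => //.
    exact/measurable_EFinP.
  move=> s _ /=; rewrite lee_fin [leRHS]ger0_norm ?addr_ge0 ?sqr_ge0//.
  (* Each coordinate is dominated by [1 + |Z|^2], from [|r| <= 1/4 + r^2]. *)
  have : (Z s ord0 i ^+ 2 <= norm2 (Z s) ^+ 2)%R.
    rewrite sqr_norm2 /dot (bigD1 i)//= -expr2 lerDl.
    by apply: sumr_ge0 => j _; rewrite -expr2 sqr_ge0.
  have := sqr_ge0 (`|Z s ord0 i| - 1 / 2)%R.
  rewrite -(real_normK (num_real (Z s ord0 i))); lra.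
have iaZ i : D.-integrable setT (fun s => (a ord0 i)%:E * (Z s ord0 i)%:E).
  exact: integrableZl.
have E : (fun s => (c + dot a (Z s) + k * norm2 (Z s) ^+ 2)%:E) =
   ((cst c%:E \+ (fun s => \sum_(i < n) ((a ord0 i)%:E * (Z s ord0 i)%:E)))
    \+ (fun s => k%:E * (norm2 (Z s) ^+ 2)%:E)).
  apply/funext => s /=; rewrite -EFinM !EFinD; congr (_ + _ + _).
  by rewrite /dot -sumEFin; apply: eq_bigr => i _; rewrite EFinM.
have iS : D.-integrable setT (fun s => \sum_(i < n) ((a ord0 i)%:E * (Z s ord0 i)%:E)).
  exact: integrable_sum.
rewrite E integralD//; [|exact: integrableD|exact: integrableZl].
rewrite integralD// integral_sum// integral_cst//.
rewrite integralZl// !EFinD EFinM; apply: leeD; last by apply: lee_wpmul2l; rewrite ?lee_fin.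
apply: leeD.
  (* The integral of the constant is [c] times the total mass, which is 1. *)
  by have := lexx c%:E; rewrite -{1}(mule1 c%:E) -(probability_setT D).
rewrite /dot -sumEFin; apply: lee_sum => i _.
by rewrite integralZl// EZ EFinM.
Qed.

(** From second to first moments by [a <= a^2 / (2 e) + e / 2] in place of Jensen. The integral of
    [f] is a lower integral, so that [f] may be the distance to a subdifferential. *)
Lemma lower_integral_le_sqrt (P : probability T R) (f : T -> \bar R)
    (a r : T -> R) (e : R) : (0 < e)%R ->
  (forall x, 0 <= f x) -> (forall x, f x <= (a x)%:E) ->
  (forall x, a x ^+ 2 <= r x)%R -> measurable_fun setT r ->
  \int[P]_x (r x)%:E <= (e ^+ 2)%:E -> \int[P]_x f x <= e%:E.
Proof.
move=> e0 f0 fa ar mr re.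
have e20 : (0 <= (2 * e)^-1)%R by rewrite invr_ge0 mulr_ge0// ltW.
have r0 x : (0 <= r x)%R by rewrite (le_trans (sqr_ge0 _) (ar x)).
apply: (@le_trans _ _ (\int[P]_x (((2 * e)^-1)%:E * (r x)%:E + (e / 2)%:E))).
  apply: ge0_le_lower_integral => // x; apply: le_trans (fa x) _.
  rewrite -EFinM -EFinD lee_fin -(@ler_pM2l _ (2 * e)) ?mulr_gt0//.
  rewrite mulrDr mulrA mulfV ?mul1r ?mulf_neq0 ?lt0r_neq0//.
  by have := ar x; have := sqr_ge0 (a x - e); lra.
rewrite ge0_integralD//; last 3 first.
- by move=> x _; rewrite mule_ge0// lee_fin.
- by apply: measurable_funeM; exact/measurable_EFinP.
- by move=> x _; rewrite lee_fin divr_ge0// ltW.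
rewrite ge0_integralZl//; last 2 first.
- exact/measurable_EFinP.
- by move=> x _; rewrite lee_fin.
apply: (@le_trans _ _ (((2 * e)^-1)%:E * (e ^+ 2)%:E + (e / 2)%:E)).
  apply: leeD; first by apply: lee_wpmul2l; rewrite ?lee_fin.
  rewrite integral_cst//.
  by have := lexx (e / 2)%:E; rewrite -{1}(mule1 (e / 2)%:E) -(probability_setT P).
rewrite -EFinM -EFinD lee_fin le_eqVlt; apply/orP; left; apply/eqP.
by field; exact: lt0r_neq0.
Qed.

End Integrals.

(** * The scalar recursion and the constants *)

Section Numeric.
Context {R : realType}.

(* [expR 1 <= (8/7)^8 < 3] because [expR (- 1/8) >= 7/8]. *)
Lemma exprD1n_le (q : R) (T : nat) : 0 <= q -> q * T%:R <= 1 ->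
  (1 + q) ^+ T <= (8 / 7) ^+ 8.
Proof.
move=> q0 qT; apply: (@le_trans _ _ (expR 1)).
  apply: (@le_trans _ _ (expR q ^+ T)).
    by rewrite lerXn2r ?nnegrE ?expR_ge0 ?addr_ge0 ?expR_ge1Dx.
  by rewrite -expRM_natr ler_expR.
have -> : (1 : R) = 1 / 8 * 8%:R by field.
rewrite expRM_natr lerXn2r ?nnegrE ?expR_ge0 ?divr_ge0//.
rewrite -[X in expR X]opprK expRN invf_ple ?posrE ?expR_gt0 ?divr_gt0//.
by rewrite invf_div; apply: le_trans (expR_ge1Dx _); lra.
Qed.

(** If every [r t] exceeded [e], each step would lose at least [b e - c >= b e / 2], so that [S T]
    would be at most [(1 + q)^T S_0 - T b e / 2 < 0]. *)
Lemma small_term_of_recursion (q c b e : R) (T : nat) (S r : nat -> \bar R) :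
  0 <= q -> 0 < b -> 0 <= e -> c <= b * e / 2 ->
  (0 <= S T)%E -> S 0%N \is a fin_num ->
  (forall t, (t < T)%N ->
    (S t.+1 + b%:E * r t <= (1 + q)%:E * S t + c%:E)%E) ->
  (1 + q) ^+ T * fine (S 0%N) < T%:R * (b * e / 2) ->
  exists2 t, (t < T)%N & (r t <= e%:E)%E.
Proof.
move=> q0 b0 e0 ce ST S0 rec small; apply: contrapT => none.
have big t : (t < T)%N -> (e%:E <= r t)%E.
  move=> tT; rewrite leNgt; apply/negP => rt; apply: none.
  by exists t => //; exact: ltW.
have bound t : (t <= T)%N ->
    (S t <= ((1 + q) ^+ t * fine (S 0%N) - t%:R * (b * e / 2))%:E)%E.
  elim: t => [_|t IH tT].
    by rewrite expr0 mul1r mul0r subr0 fineK.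
  have h1 : (S t.+1 + (b * e)%:E <= (1 + q)%:E * S t + c%:E)%E.
    apply: (le_trans _ (rec t tT)); apply: leeD2l; rewrite EFinM.
    by apply: lee_wpmul2l; [rewrite lee_fin ltW|exact: big].
  have h2 : ((1 + q)%:E * S t + c%:E <=
      ((1 + q) * ((1 + q) ^+ t * fine (S 0%N) - t%:R * (b * e / 2)) + c)%:E)%E.
    rewrite [in leRHS]EFinD (EFinM (1 + q)); apply: leeD2r; apply: lee_wpmul2l.
      by rewrite lee_fin addr_ge0.
    exact/IH/ltnW.
  have := le_trans h1 h2; rewrite -leeBrDr// -EFinB => /le_trans; apply.
  rewrite lee_fin exprS -(natr1 t).
  (* The factor [1 + q] also amplifies the losses already accumulated, which favours the bound. *)
  have : 0 <= t%:R * (q * (b * e / 2)).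
    by rewrite !mulr_ge0// ltW.
  move: ((1 + q) ^+ t) (fine (S 0%N)) (t%:R : R) => p v tau; lra.
have := le_trans ST (bound T (leqnn T)); rewrite lee_fin subr_ge0.
by rewrite leNgt small.
Qed.

(** Here [tau] is [T] and [v] the initial potential. Each entry of the maximum for [beta] is matched
    with one entry of the maximum for [T]; the factor 12 later absorbs [(1 + Q)^T]. *)
Lemma threshold_le (k1 k2 LM A C eps v tau : R) : 0 < k1 -> 0 < LM ->
  0 <= A -> 0 < eps -> 0 <= v -> 0 <= tau ->
  12 * LM / eps ^+ 2 * v * Num.max (Num.max (2 * C / eps ^+ 2) (12 / eps ^+ 2 * v * A))
    (2 * k2 / (k1 * LM)) <= tau ->
  12 * v * Num.max (Num.max (Num.sqrt (LM * A * tau)) (2 * k2 / k1))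
    (2 * LM * C / eps ^+ 2) <= tau * eps ^+ 2.
Proof.
move=> k10 LM0 A0 e0 v0 tau0 h.
have e20 : 0 < eps ^+ 2 by rewrite exprn_gt0.
have p0 : 0 <= 12 * LM / eps ^+ 2 * v.
  by apply: mulr_ge0 v0; apply: divr_ge0 (ltW e20); rewrite mulr_ge0// ltW.
have {h} leT r : r <= Num.max (Num.max (2 * C / eps ^+ 2) (12 / eps ^+ 2 * v * A))
    (2 * k2 / (k1 * LM)) -> 12 * LM * v * r <= tau * eps ^+ 2.
  move=> rle; rewrite -ler_pdivrMr//; apply: le_trans h.
  apply: le_trans (ler_wpM2l p0 rle).
  by rewrite le_eqVlt; apply/orP; left; apply/eqP; ring.
rewrite !maxr_pMr ?mulr_ge0// !ge_max -andbA; apply/and3P; split.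
(* Squared, the goal reads [144 v^2 LM A tau <= tau^2 eps^4]: one [tau] comes from the threshold,
   the other is common to both sides. *)
- rewrite -(@ler_pXn2r _ 2)// ?nnegrE ?mulr_ge0 ?sqrtr_ge0 ?(ltW e0)//.
  rewrite exprMn sqr_sqrtr ?mulr_ge0 ?(ltW LM0)//.
  have := leT (12 / eps ^+ 2 * v * A).
  rewrite !le_max lexx orbT => /(_ isT) hT.
  have {}hT : 144 * LM * A * v ^+ 2 <= tau * eps ^+ 2 * eps ^+ 2.
    rewrite -ler_pdivrMr//; apply: le_trans hT.
    by rewrite le_eqVlt; apply/orP; left; apply/eqP; field; exact: lt0r_neq0.
  have := ler_wpM2r tau0 hT; rewrite (exprMn _ tau); lra.
- have <- : 12 * LM * v * (2 * k2 / (k1 * LM)) = 12 * v * (2 * k2 / k1).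
    by field; rewrite !lt0r_neq0.
  by apply: leT; rewrite le_max lexx orbT.
- have <- : 12 * LM * v * (2 * C / eps ^+ 2) = 12 * v * (2 * LM * C / eps ^+ 2).
    by field; exact: lt0r_neq0.
  by apply: leT; rewrite !le_max lexx.
Qed.

End Numeric.

(** * Inequalities between the constants *)

Section Constants.
Context {R : realType} (l L2s L4s L5s gamma : R).
Context (L2s0 : 0 <= L2s) (L4s0 : 0 <= L4s).
Context (gamma0 : 0 < gamma) (k10 : 0 < K1 l L2s gamma).
Context (gammaL : (L2s ^+ 2 + L5s ^+ 2) * gamma ^+ 2 <= 1).

Let k1 := K1 l L2s gamma.
Let k2 := K2 L2s gamma.
Let M := constM l L2s L4s gamma.

Lemma K2_gt0 : 0 < k2.
Proof.
have g2 : 0 < 1 + gamma * L2s by rewrite ltr_wpDr// mulr_ge0// ltW.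
by rewrite divr_gt0// mulr_gt0// exprn_gt0.
Qed.

Lemma K2E : k2 = 5 / 4 * (gamma^-1 + L2s) ^+ 2.
Proof. by rewrite /k2 /K2; field; exact: lt0r_neq0. Qed.

Lemma K1E : k1 = gamma^-1 / 4 - 5 / 2 * (l + L2s) - 1 - 5 / 4 * L2s ^+ 2 * gamma.
Proof. by rewrite /k1 /K1; field; exact: lt0r_neq0. Qed.

Lemma constM_ge : 2 * L4s + 10 * gamma * L4s ^+ 2 + 10 * k1 * L4s ^+ 2 / k2 <= M.
Proof. by rewrite /M /constM /K3 -/k1 -/k2; lra. Qed.

Lemma constM_ge0 : 0 <= M.
Proof.
apply: le_trans constM_ge; have k2_ge0 := ltW K2_gt0.
have k1_ge0 : 0 <= k1 by exact: ltW.
have gamma_ge0 := ltW gamma0.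
move: k1 k2 k1_ge0 k2_ge0 => a b a_ge0 b_ge0.
by rewrite !(addr_ge0, divr_ge0, mulr_ge0, sqr_ge0).
Qed.

Lemma gammaL5s_le : L5s ^+ 2 <= gamma^-1 ^+ 2.
Proof.
have <- : L5s ^+ 2 * gamma ^+ 2 * gamma^-1 ^+ 2 = L5s ^+ 2.
  by rewrite -mulrA -exprMn mulfV ?lt0r_neq0// expr1n mulr1.
apply: ler_piMl; first exact: sqr_ge0.
by apply: le_trans gammaL; rewrite ler_wpM2r ?sqr_ge0// lerDr sqr_ge0.
Qed.

(** [12 / 5 * k2] is [3 (gamma^-1 + L2s)^2], and [L5s ^+ 2 <= gamma^-1 ^+ 2]. The left side is the
    coefficient of [norm2 (u - x) ^+ 2] in the bound on the residual. *)
Lemma residual_coef : 2 * L5s ^+ 2 + (gamma^-1 + L2s) ^+ 2 <= 12 / 5 * k2.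
Proof.
have g0 : 0 <= gamma^-1 by rewrite invr_ge0 ltW.
have : gamma^-1 ^+ 2 <= (gamma^-1 + L2s) ^+ 2.
  by rewrite ler_pXn2r ?nnegrE ?addr_ge0// lerDl.
have := gammaL5s_le; rewrite K2E; lra.
Qed.

(** [x_descent] and [y_slack] are the coefficients of [|x' - x|^2] and [|y' - y|^2] left after
    paying for [gamma^-1 |u - x'|^2]: the first comes from the growth at the x-step, the second from
    inflating [L] to [L + M]. *)
Definition x_descent : R := gamma^-1 / 2 - l / 2 - 2 * gamma * L2s ^+ 2.
Definition y_slack : R := M / 2 - 2 * gamma * L4s ^+ 2.

(** Here [a], [b], [r] stand for the lengths of [x' - x], [y' - y], [u - x]. The bound on [beta]
    gives [beta * x_descent >= 4 k2] and [beta * y_slack >= 24 k2 (gamma L4s)^2], while [6/5 r^2]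
    costs at most [3.78 a^2 + 3.6 (gamma L4s)^2 b^2]. *)
Lemma step_residual (beta a b r : R) : 0 <= l + L2s ->
  2 * k2 / k1 < beta -> 0 <= a -> 0 <= b -> 0 <= r ->
  r <= (1 + gamma * L2s) * a + gamma * L4s * b ->
  6 / 5 * k2 * r ^+ 2 <= beta * (x_descent * a ^+ 2 + y_slack * b ^+ 2).
Proof.
move=> lL; rewrite ltr_pdivrMr// -/k1 => bk a0 b0 r0 rle.
have g0 : 0 < gamma^-1 by rewrite invr_gt0.
have gV : gamma * gamma^-1 = 1 by rewrite divff// lt0r_neq0.
have k20 := K2_gt0.
have q0 : 0 <= gamma * L2s ^+ 2 by rewrite mulr_ge0 ?sqr_ge0// ltW.
have p0 : 0 <= gamma * L4s ^+ 2 by rewrite mulr_ge0 ?sqr_ge0// ltW.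
have k1le : k1 <= gamma^-1 / 4 by rewrite K1E; lra.
(* As [l + L2s >= 0], positivity of [K1] makes its first term exceed its last one. *)
have sle : (gamma * L2s) ^+ 2 <= 1 / 5.
  have : 0 < gamma * (gamma^-1 / 4 - 5 / 4 * (gamma * L2s ^+ 2)).
    by rewrite mulr_gt0//; move: k10; rewrite -/k1 K1E; lra.
  by rewrite exprMn; nra.
have s0 : 0 <= gamma * L2s by rewrite mulr_ge0// ltW.
have ble : 8 * gamma * k2 <= beta.
  have b1 : 0 < beta by rewrite -(@pmulr_lgt0 _ k1)//; lra.
  have : 0 <= gamma * (beta * (gamma^-1 / 4) - 2 * k2) by rewrite mulr_ge0 ?ltW//; nra.
  nra.
have beta0 : 0 < beta by apply: lt_le_trans ble; do 2!rewrite mulr_gt0//.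
have xd : 4 * k2 <= beta * x_descent.
  have : 2 * k1 <= x_descent by rewrite K1E /x_descent; have := L2s0; lra.
  by move=> h; nra.
have ys : 24 * k2 * (gamma * L4s) ^+ 2 <= beta * y_slack.
  have : 3 * (gamma * L4s ^+ 2) <= y_slack.
    rewrite /y_slack; have := constM_ge; have := L4s0.
    have : 0 <= 10 * k1 * L4s ^+ 2 / k2.
      apply: divr_ge0 (ltW k20); apply: mulr_ge0 (sqr_ge0 _).
      by rewrite mulr_ge0// ltW.
    lra.
  move=> h; apply: le_trans (ler_wpM2l (ltW beta0) h).
  have := ler_wpM2r p0 ble; lra.
(* [63/20 = 3/2 * 21/10]: the square of the sum is split with weights 3/2 and 3, and
   [(1 + gamma L2s)^2 <= 21/10]. *)
have r2 : r ^+ 2 <= 63 / 20 * a ^+ 2 + 3 * (gamma * L4s) ^+ 2 * b ^+ 2.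
  have : r ^+ 2 <= ((1 + gamma * L2s) * a + gamma * L4s * b) ^+ 2.
    by rewrite ler_pXn2r// nnegrE// (le_trans r0).
  move: (gamma * L2s) (gamma * L4s) sle s0 => t w tle t0 h.
  have h1 : (1 + t) ^+ 2 <= 21 / 10 by have := sqr_ge0 (t - 1 / 2); lra.
  have h2 := ler_wpM2r (sqr_ge0 a) h1.
  have := sqr_ge0 ((1 + t) * a - 2 * (w * b)); lra.
have := ler_wpM2l (ltW k20) r2.
have := ler_wpM2r (sqr_ge0 a) xd; have := ler_wpM2r (sqr_ge0 b) ys.
have := mulr_ge0 (ltW k20) (sqr_ge0 a).
have := mulr_ge0 (ltW k20) (mulr_ge0 (sqr_ge0 (gamma * L4s)) (sqr_ge0 b)).
lra.
Qed.

End Constants.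

(** * One iteration of STAM along a path *)

Lemma ereal_sup_range_le {R : realType} {T : Type} (f : T -> R) (c : R) :
  (ereal_sup (range (fun t => (f t)%:E)) <= c%:E)%E -> forall t, f t <= c.
Proof.
move=> fc t; rewrite -lee_fin; apply: le_trans fc.
by apply: ereal_sup_ubound; exists t.
Qed.

Section Pathwise.
Context {R : realType} {n : nat}.
Notation V := 'rV[R]_n.
Context {F : V -> \bar R} {G : V -> R} {H : V -> V -> R}.
Context {L1 : R} {L2 L3 L4 L5 : V -> R} {L2s L3s L4s L5s L l gamma : R}.
Context (Fp : proper F).
Context (Hlb : has_lbound (range (fun p : V * V => H p.1 p.2))).
Context (a1 : assumption_a1 G L1) (a2 : assumption_a2 H L2 L3 L4 L5).
Context (a3 : assumption_a3 H L1 L2 L3 L4 L5 L2s L3s L4s L5s L l).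
Context (gamma0 : 0 < gamma).

Lemma L2s_ge0 : 0 <= L2s. Proof. by case: a3 => -[]. Qed.
Lemma L3s_ge0 : 0 <= L3s. Proof. by case: a3 => -[]. Qed.
Lemma L4s_ge0 : 0 <= L4s. Proof. by case: a3 => -[]. Qed.
Lemma L5s_ge0 : 0 <= L5s. Proof. by case: a3 => -[]. Qed.
Lemma L1_gt0 : 0 < L1. Proof. by case: a1. Qed.
Lemma L_gt0 : 0 < L. Proof. by case: a3 => _ _ []. Qed.
Lemma L3s1_le : L3s + L1 <= L. Proof. by case: a3 => _ _ []. Qed.

Lemma differentiableG y : differentiable G y. Proof. by case: a1. Qed.
Lemma differentiableHx y x : differentiable (H ^~ y) x.
Proof. by case: a2. Qed.
Lemma differentiableHy x y : differentiable (H x) y.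
Proof. by case: a2. Qed.

Lemma gradG_lip y1 y2 : norm2 (grad G y1 - grad G y2) <= L1 * norm2 (y1 - y2).
Proof. by case: a1. Qed.

Lemma gradx_lipx y x1 x2 :
  norm2 (grad (H ^~ y) x1 - grad (H ^~ y) x2) <= L2s * norm2 (x1 - x2).
Proof.
case: a2 a3 => _ _ _ [+ _ _ _] [_ [/ereal_sup_range_le + _ _ _] _ _].
move=> /(_ x1 x2 y) h /(_ y) h'; apply: le_trans h _.
by rewrite ler_wpM2r ?norm2_ge0.
Qed.

Lemma gradx_lipy x y1 y2 :
  norm2 (gradx H x y1 - gradx H x y2) <= L4s * norm2 (y1 - y2).
Proof.
case: a2 a3 => _ _ _ [_ + _ _] [_ [_ _ /ereal_sup_range_le + _] _ _].
move=> /(_ x y1 y2) h /(_ x) h'; apply: le_trans h _.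
by rewrite ler_wpM2r ?norm2_ge0.
Qed.

Lemma grady_lipy x y1 y2 :
  norm2 (grad (H x) y1 - grad (H x) y2) <= L3s * norm2 (y1 - y2).
Proof.
case: a2 a3 => _ _ _ [_ _ + _] [_ [_ /ereal_sup_range_le + _ _] _ _].
move=> /(_ x y1 y2) h /(_ x) h'; apply: le_trans h _.
by rewrite ler_wpM2r ?norm2_ge0.
Qed.

Lemma grady_lipx x1 x2 y :
  norm2 (grady H x1 y - grady H x2 y) <= L5s * norm2 (x1 - x2).
Proof.
case: a2 a3 => _ _ _ [_ _ _ +] [_ [_ _ _ /ereal_sup_range_le +] _ _].
move=> /(_ x1 x2 y) h /(_ y) h'; apply: le_trans h _.
by rewrite ler_wpM2r ?norm2_ge0.
Qed.

Lemma L3s_gt0 : 0 < L3s.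
Proof.
case: a2 a3 => _ _ /(_ 0) [_ L30 _ _] _ [_ [_ /ereal_sup_range_le h _ _] _ _].
exact: lt_le_trans L30 (h _).
Qed.

Lemma weakly_convexH y :
  convex_function setT (fun x : V => H x y + l / 2 * norm2 x ^+ 2).
Proof. by case: a3 => _ _ _; apply. Qed.

Lemma infG_le y : inf (range G) <= G y.
Proof. by apply: ge_inf; [case: a1|exists y]. Qed.

Lemma infH_le x y : infH H <= H x y.
Proof. by apply: ge_inf; [|exists (x, y)]. Qed.

Lemma infGH_le x y : infGH G H <= G y + H x y.
Proof.
apply: ge_inf; last by exists (x, y).
(* [inf] is meaningful only on a set bounded below; the separate infima provide the bound. *)
exists (inf (range G) + infH H) => _ [[x' y'] _ <-] /=.
by rewrite lerD ?infG_le ?infH_le.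
Qed.

Lemma infGH_ge : inf (range G) + infH H <= infGH G H.
Proof.
apply: lb_le_inf; first by exists (G 0 + H 0 0); exists (0, 0).
by move=> _ [[x' y'] _ <-] /=; rewrite lerD ?infG_le ?infH_le.
Qed.

(** * Optimality conditions at one iterate *)

Section Point.
Context {y zp x u z : V} (pt : xuz_update F H gamma y zp x u z).

Lemma prox_pointE : zp = x + gamma *: gradx H x y.
Proof.
case: pt => xmin _ _; apply: argmin_grad0 gamma0 L2s_ge0 _ _ xmin.
- by move=> x'; exact: differentiableHx.
- exact: gradx_lipx.
Qed.

Lemma shadow_pointE : z = u + gamma *: gradx H x y.
Proof. by case: pt => _ _ ->; rewrite prox_pointE [LHS]addrC addrA subrK. Qed.

Lemma F_fin_num : F u \is a fin_num.
Proof. by case: pt => _ umin _; exact: argmin_fin_num umin. Qed.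

(** The u-step yields an explicit limiting subgradient [s]; eliminating [zp] by the x-step condition
    turns [gradx H u y + s] into a gradient difference plus [gamma^-1 *: (x - u)]. *)
Lemma dist0_residual :
  (dist0 [set (gradx H u y + s)%R | s in limiting_subdiff F u] <=
   ((gamma^-1 + L2s) * norm2 (u - x))%:E)%E.
Proof.
have [_ umin _] := pt.
pose s := gamma^-1 *: ((2 *: x - zp) - u).
have sF : limiting_subdiff F u s by exact: prox_limiting.
apply: (@le_trans _ _ (norm2 (gradx H u y + s))%:E).
  by apply: dist0_le; exists s.
have -> : gradx H u y + s = (gradx H u y - gradx H x y) + gamma^-1 *: (x - u).
  rewrite /s prox_pointE; move: (gradx H x y) (gradx H u y) => p q.
  by apply/rowP => i; rewrite !mxE; field; exact: lt0r_neq0.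
rewrite lee_fin; apply: le_trans (norm2D _ _) _.
rewrite norm2Z gtr0_norm ?invr_gt0// (norm2B x) mulrDl addrC lerD2l.
exact: gradx_lipx.
Qed.

End Point.

Definition merit_fine (x u z : V) : R :=
  fine (F u) + ((2 * gamma)^-1 * norm2 (2 *: x - u - z) ^+ 2
    - (2 * gamma)^-1 * norm2 (x - z) ^+ 2 - gamma^-1 * norm2 (u - x) ^+ 2).

Lemma merit_fineE x u z : F u \is a fin_num ->
  merit F gamma x u z = (merit_fine x u z)%:E.
Proof. by move=> Fu; rewrite /merit -{1}(fineK Fu). Qed.

(** * Two consecutive iterates *)

Section Step.
Context {y zp x u z : V} (pt : xuz_update F H gamma y zp x u z).
Context {y' x' u' z' : V} (pt' : xuz_update F H gamma y' z x' u' z').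

(** The point [z] is both [u + gamma gradx H x y] and [x' + gamma gradx H x' y']; the difference of
    gradients is split at [(x, y')]. *)
Lemma prox_gap : norm2 (u - x') <=
  gamma * (L2s * norm2 (x' - x) + L4s * norm2 (y' - y)).
Proof.
have -> : u - x' = gamma *: ((gradx H x' y' - gradx H x y') +
                             (gradx H x y' - gradx H x y)).
  have := shadow_pointE pt; rewrite (prox_pointE pt') => /eqP.
  rewrite addrC -subr_eq => /eqP <-; rewrite addrA subrK scalerBr.
  by rewrite [LHS]addrAC addrK.
rewrite norm2Z gtr0_norm// ler_pM2l//; apply: le_trans (norm2D _ _) _.
by apply: lerD; [exact: gradx_lipx|exact: gradx_lipy].
Qed.

Lemma fixed_gap : norm2 (u - x) <=
  (1 + gamma * L2s) * norm2 (x' - x) + gamma * L4s * norm2 (y' - y).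
Proof.
rewrite -(subrKA x' u (- x)); apply: le_trans (norm2D _ _) _.
have := prox_gap; lra.
Qed.

(* As a function of x, the merit is (2 gamma)^-1 |x - z|^2 up to a constant, so
   that the x-update minimises H (., y') plus the merit; the changes due to
   the u- and z-updates cancel up to the last term. *)
Lemma merit_descent :
  H x' y' + merit_fine x' u' z' <= H x y' + merit_fine x u z
    - (gamma^-1 - l) / 2 * norm2 (x' - x) ^+ 2 + gamma^-1 * norm2 (u - x') ^+ 2.
Proof.
have [xmin umin zE] := pt'.
have := argmin_strong x (@weakly_convexH y') xmin.
have := umin u; rewrite -(fineK (F_fin_num pt)) -(fineK (F_fin_num pt')).
rewrite -!EFinD lee_fin /merit_fine zE.
(* With a single coefficient [(2 * gamma)^-1] and inner products in a fixed order, the claim becomes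
   linear in the remaining products. *)
have -> : gamma^-1 = 2 * (2 * gamma)^-1 by field; exact: lt0r_neq0.
move: (2 * gamma)^-1 (fine (F u)) (fine (F u')) => h f f'.
rewrite !sqr_norm2 !dotE.
rewrite ?(dotC x' x) ?(dotC u x) ?(dotC u x') ?(dotC u' x) ?(dotC u' x').
rewrite ?(dotC u' u) ?(dotC z x) ?(dotC z x') ?(dotC z u) ?(dotC z u').
lra.
Qed.

End Step.

Definition gap (y x : V) : R := G y + H x y - infGH G H.

Definition total_grad (y x : V) : V := grad G y + grady H x y.

(* Upper bound for the gap at (y - q / beta, x), with the quadratic term inflated
   by M to absorb the x-update. *)
Definition gap_model (M beta : R) (y x q : V) : R :=
  gap y x - beta^-1 * dot (total_grad y x) q
  + (L + M) / (2 * beta ^+ 2) * norm2 q ^+ 2.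

(* The second summand bounds the squared distance of 0 to the subdifferential. *)
Definition residual (y x u : V) : R :=
  norm2 (total_grad y u) ^+ 2 + ((gamma^-1 + L2s) * norm2 (u - x)) ^+ 2.

Lemma gap_ge0 y x : 0 <= gap y x.
Proof. by rewrite subr_ge0 infGH_le. Qed.

(** Completing the square, the objective exceeds its value at [y - beta^-1 *: p] by [beta / 2] times
    the squared distance to that point. *)
Lemma y_updateE beta q y x y' : 0 < beta ->
  y_update H beta q x y y' -> y' = y - beta^-1 *: (q + grady H x y).
Proof.
move=> beta0; rewrite /y_update; move: (q + grady H x y) => p ymin.
have := ymin (y - beta^-1 *: p).
rewrite (addrAC y _ (- y)) subrr sub0r.
have [v vE] : exists v, v = y' - y by eexists.
rewrite -vE !sqr_norm2 !dotE => h.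
suff /dot_eq0/addr0_eq <- : dot (v + beta^-1 *: p) (v + beta^-1 *: p) = 0.
  by rewrite opprK vE addrC subrK.
apply/le_anti; rewrite dot_ge0 andbT -(@pmulr_rle0 _ (beta / 2)) ?divr_gt0//.
rewrite !dotE (dotC v p).
have e (c : R) : beta / 2 * (beta^-1 * c) = c / 2 by field; exact: lt0r_neq0.
have := e (dot p v); have := e (beta^-1 * dot p p); lra.
Qed.

(** The direction [q] is arbitrary, so that it may be the noisy estimate; [L3s + L1 <= L] controls
    the curvature of [G + H x]. *)
Lemma gap_descent beta y x q : 0 < beta ->
  gap (y - beta^-1 *: q) x <= gap y x - beta^-1 * dot (total_grad y x) q
                              + L / 2 * norm2 (beta^-1 *: q) ^+ 2.
Proof.
move=> beta0; rewrite /gap /total_grad.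
have := descent (@differentiableG) gradG_lip y (- (beta^-1 *: q)).
have := descent (@differentiableHy x) (@grady_lipy x) y (- (beta^-1 *: q)).
have : 0 <= (L - (L3s + L1)) * norm2 (beta^-1 *: q) ^+ 2.
  by rewrite mulr_ge0 ?sqr_ge0// subr_ge0 L3s1_le.
rewrite norm2N !dotE -/(grady H x y); lra.
Qed.

(** * One-step decrease of the potential *)

Section Potential.
Context (k10 : 0 < K1 l L2s gamma).
Context (gammaL : (L2s ^+ 2 + L5s ^+ 2) * gamma ^+ 2 <= 1).
Context {beta : R} (betaK : 2 * K2 L2s gamma / K1 l L2s gamma < beta).
Let M := constM l L2s L4s gamma.

Lemma beta_gt0 : 0 < beta.
Proof.
apply: le_lt_trans betaK; apply: divr_ge0 (ltW k10).
by rewrite mulr_ge0// ltW// K2_gt0// L2s_ge0.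
Qed.

Lemma M_ge0 : 0 <= M.
Proof. by apply: constM_ge0 => //; [exact: L2s_ge0|exact: L4s_ge0]. Qed.

Lemma LM_gt0 : 0 < L + M. Proof. by rewrite ltr_wpDr ?M_ge0 ?L_gt0. Qed.

(** The model dominates the gap at the next [y]. Its sign is what later allows Tonelli. *)
Lemma gap_model_ge0 y x q : 0 <= gap_model M beta y x q.
Proof.
have b0 := beta_gt0.
apply: le_trans (gap_ge0 (y - beta^-1 *: q) x) _.
apply: le_trans (gap_descent _ _ _ b0) _; rewrite lerD2l.
rewrite norm2Z gtr0_norm ?invr_gt0// exprMn exprVn mulrA ler_wpM2r ?sqr_ge0//.
rewrite (invfM 2) mulrA ler_wpM2r ?invr_ge0 ?sqr_ge0// ler_wpM2r ?invr_ge0//.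
by rewrite lerDl M_ge0.
Qed.

(** The y-step and x-step inequalities are added; the surplus in [x_descent] and [y_slack] pays for
    the [norm2 (u - x)] part of the residual, and [beta^-1 * norm2 (total_grad y x) ^+ 2], which
    cancels in expectation, for its gradient part. *)
Lemma potential_step y zp x u z y' x' u' z' q :
  xuz_update F H gamma y zp x u z -> xuz_update F H gamma y' z x' u' z' ->
  y' = y - beta^-1 *: q ->
  gap y' x' + merit_fine x' u' z' + residual y x u / (2 * beta) <=
  gap_model M beta y x q + beta^-1 * norm2 (total_grad y x) ^+ 2
  + merit_fine x u z.
Proof.
move=> pt pt' yE; have b0 := beta_gt0.
pose a := norm2 (x' - x); pose b := norm2 (y' - y); pose r := norm2 (u - x).
have q2 : norm2 (beta^-1 *: q) ^+ 2 = b ^+ 2.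
  by rewrite /b yE addrAC subrr sub0r norm2N.
have rle : r <= (1 + gamma * L2s) * a + gamma * L4s * b by apply: (fixed_gap pt pt').
have ux : gamma^-1 * norm2 (u - x') ^+ 2 <=
    2 * gamma * L2s ^+ 2 * a ^+ 2 + 2 * gamma * L4s ^+ 2 * b ^+ 2.
  have := prox_gap pt pt'; rewrite -/a -/b => h.
  have {}h : norm2 (u - x') ^+ 2 <= (gamma * (L2s * a + L4s * b)) ^+ 2.
    by rewrite ler_pXn2r ?nnegrE ?norm2_ge0// (le_trans (norm2_ge0 _) h).
  rewrite mulrC ler_pdivrMr//; apply: le_trans h _.
  have := mulr_ge0 (sqr_ge0 gamma) (sqr_ge0 (L2s * a - L4s * b)); lra.
have step : 6 / 5 * K2 L2s gamma * r ^+ 2 <=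
    beta * (x_descent l L2s gamma * a ^+ 2 + y_slack l L2s L4s gamma * b ^+ 2).
  have [lL|lL] := leP 0 (l + L2s).
    by apply: step_residual; rewrite ?L2s_ge0 ?L4s_ge0 ?norm2_ge0.
  (* l + L2s < 0 is only possible in dimension 0. *)
  have n0 (v : V) : norm2 v = 0.
    have := convex_lipschitz_ge0 (@differentiableHx 0) (@gradx_lipx 0)
      (@weakly_convexH 0) v.
    by rewrite nmulr_rge0// => v0; apply/eqP; rewrite -sqrf_eq0 eq_le v0 sqr_ge0.
  by rewrite /a /b /r !n0 expr0n /= !mulr0 addr0 mulr0.
have res : residual y x u <=
    2 * norm2 (total_grad y x) ^+ 2 + 12 / 5 * K2 L2s gamma * r ^+ 2.
  rewrite /residual -/r exprMn.
  have : norm2 (total_grad y u) ^+ 2 <=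
      2 * norm2 (total_grad y x) ^+ 2 + 2 * (L5s ^+ 2 * r ^+ 2).
    rewrite (_ : total_grad y u = total_grad y x + (grady H u y - grady H x y)).
      apply: le_trans (sqr_norm2D_le _ _) _; rewrite lerD2l ler_pM2l// -exprMn.
      by rewrite ler_pXn2r ?nnegrE ?mulr_ge0 ?norm2_ge0 ?L5s_ge0// grady_lipx.
    by rewrite /total_grad -[RHS]addrA (addrC (grady H x y)) subrK.
  have := ler_wpM2r (sqr_ge0 r) (residual_coef L2s_ge0 gamma0 gammaL); lra.
have := gap_descent y x q b0; rewrite -yE q2.
have := merit_descent pt pt'; rewrite -/a.
have {}res : residual y x u / (2 * beta) <= beta^-1 * norm2 (total_grad y x) ^+ 2
    + (x_descent l L2s gamma * a ^+ 2 + y_slack l L2s L4s gamma * b ^+ 2).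
  rewrite ler_pdivrMr ?mulr_gt0//.
  have : beta^-1 * norm2 (total_grad y x) ^+ 2 * (2 * beta) =
      2 * norm2 (total_grad y x) ^+ 2.
    by field; exact: lt0r_neq0.
  lra.
have qb : (L + M) / (2 * beta ^+ 2) * norm2 q ^+ 2 = (L + M) / 2 * b ^+ 2.
  rewrite -q2 norm2Z gtr0_norm ?invr_gt0// exprMn.
  by field; exact: lt0r_neq0.
rewrite /gap_model qb; move: res ux; rewrite /gap /x_descent /y_slack -/M; lra.
Qed.

Lemma sqr_gradG_le y : norm2 (grad G y) ^+ 2 <= 2 * L1 * (G y - inf (range G)).
Proof. exact: sqr_grad_le L1_gt0 differentiableG gradG_lip infG_le y. Qed.

Lemma sqr_grady_le x y : norm2 (grady H x y) ^+ 2 <= 2 * L3s * (H x y - infH H).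
Proof.
exact: sqr_grad_le L3s_gt0 (@differentiableHy x) (@grady_lipy x) (@infH_le x) y.
Qed.

(** * Measurability of the problem functions *)

Lemma lipschitz_coord_continuous (f : V -> V) (c : R) :
  (forall x y, norm2 (f x - f y) <= c * norm2 (x - y)) ->
  forall i, continuous (fun x => f x 0 i).
Proof.
move=> lip i x; apply/(@cvgrPdist_le _ _ _ (nbhs x) _ (fun y => f y 0 i)) => e e0.
have c0 : 0 < `|c| + 1 by rewrite ltr_wpDl.
near=> y.
have : norm2 (y - x) < e / (`|c| + 1).
  by near: y; apply: near_norm2_lt; rewrite divr_gt0.
rewrite ltr_pdivlMr// => xy.
have : (f x 0 i - f y 0 i) ^+ 2 <= norm2 (f x - f y) ^+ 2.
  rewrite sqr_norm2 /dot (bigD1 i)//= !mxE -expr2 lerDl.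
  by apply: sumr_ge0 => j _; rewrite -expr2 sqr_ge0.
rewrite -(real_normK (num_real (_ - _))) ler_pXn2r ?nnegrE ?norm2_ge0// => h.
apply: le_trans h _; apply: le_trans (lip x y) _.
rewrite (norm2B x y); apply: le_trans (ltW xy); rewrite mulrC.
by rewrite ler_wpM2l ?norm2_ge0// (le_trans (ler_norm c))// lerDl.
Unshelve. all: by end_near. Qed.

Notation bV := (borel_rV R n).

Lemma measurable_H :
  measurable_fun setT (fun p : bV * bV => H (p.1 : V) (p.2 : V)).
Proof.
apply: (@caratheodory_measurable _ _ _ bV H) => [y x|x].
  exact/differentiable_continuous/differentiableHx.
apply: continuous_borel => y.
exact/differentiable_continuous/differentiableHy.
Qed.

Lemma measurable_G : measurable_fun setT (G : bV -> R).
Proof.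
by apply: continuous_borel => y; exact/differentiable_continuous/differentiableG.
Qed.

Lemma measurable_gradG i : measurable_fun setT (fun y : bV => grad G (y : V) 0 i).
Proof. by apply: continuous_borel; exact: lipschitz_coord_continuous gradG_lip i. Qed.

Lemma measurable_grady i :
  measurable_fun setT (fun p : bV * bV => grady H (p.1 : V) (p.2 : V) 0 i).
Proof.
apply: (@caratheodory_measurable _ _ _ bV (fun x y => grady H x y 0 i)) => [y|x].
  by apply: lipschitz_coord_continuous => x1 x2; exact: grady_lipx.
apply: continuous_borel; apply: lipschitz_coord_continuous; exact: grady_lipy.
Qed.

Lemma measurable_gap : measurable_fun setT (fun p : bV * bV => gap (p.2 : V) (p.1 : V)).
Proof.
apply: measurable_funB => //; apply: measurable_funD; last exact: measurable_H.
exact: measurableT_comp measurable_G measurable_snd.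
Qed.

Lemma measurable_total_grad i :
  measurable_fun setT (fun p : bV * bV => total_grad (p.2 : V) (p.1 : V) 0 i).
Proof.
under eq_fun do rewrite mxE.
apply: measurable_funD; last exact: measurable_grady.
exact: measurableT_comp (measurable_gradG i) measurable_snd.
Qed.

(** * Averaging over the samples *)

Section Stochastic.
Context {dXi : measure_display} {Xi : measurableType dXi} {D : probability Xi R}.
Context {g : V -> Xi -> V} {A0 B0 C0 : R}.
Context (mg : measurable_fun setT (fun p : bV * Xi => (g p.1 p.2 : bV))).
Context (gE : unbiased D G g) (gS : expected_smoothness D G g A0 B0 C0).
Let A := constA A0 B0 L1 L3s.
Let C := constC G H A C0.

Lemma constA_ge0 : 0 <= A.
Proof. by rewrite le_max mulr_ge0 ?L3s_ge0 ?orbT. Qed.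

Lemma constC_ge0 : 0 <= C.
Proof.
case: gS => _ _ C00 _; rewrite /C /constC addr_ge0 ?mulr_ge0 ?constA_ge0//.
by rewrite -addrA -opprD subr_ge0 infGH_ge.
Qed.

(** Squared gradients are bounded by multiples of function gaps, [A] majorises both coefficients,
    and [C] collects the offset between the three infima. The factors 2 on the left come from
    splitting the squared norm of a sum. *)
Lemma second_moment_le y x :
  2 * (2 * A0 * (G y - inf (range G)) + B0 * norm2 (grad G y) ^+ 2 + C0)
    + 2 * norm2 (grady H x y) ^+ 2 <= 2 * A * gap y x + C.
Proof.
case: gS => A00 B00 _ _.
have h1 : 2 * A0 + 2 * B0 * L1 <= A by rewrite /A /constA le_max lexx.
have h2 : 2 * L3s <= A by rewrite /A /constA le_max lexx orbT.
have g0 : 0 <= G y - inf (range G) by rewrite subr_ge0 infG_le.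
have h0 : 0 <= H x y - infH H by rewrite subr_ge0 infH_le.
have := ler_wpM2r g0 h1; have := ler_wpM2r h0 h2.
have := ler_wpM2l B00 (sqr_gradG_le y); have := sqr_grady_le x y.
by rewrite /C /constC /gap; lra.
Qed.

Definition estimator (y x : V) (s : Xi) : V := g y s + grady H x y.

Lemma measurable_estimator i : measurable_fun setT
  (fun p : (bV * bV) * Xi => estimator (p.1.2 : V) (p.1.1 : V) p.2 0 i).
Proof.
under eq_fun do rewrite mxE; apply: measurable_funD.
  apply: (measurableT_comp (@coord_borel R n i)).
  have mp : measurable_fun setT (fun p : (bV * bV) * Xi => (p.1.2, p.2)).
    apply: measurable_fun_pair => //.
    exact: measurableT_comp measurable_snd measurable_fst.
  exact: measurableT_comp mg mp.
exact: measurableT_comp (measurable_grady i) measurable_fst.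
Qed.

Lemma measurable_gap_model N : measurable_fun setT
  (fun p : (bV * bV) * Xi => gap_model N beta (p.1.2 : V) (p.1.1 : V)
     (estimator (p.1.2 : V) (p.1.1 : V) p.2)).
Proof.
apply: measurable_funD.
  apply: measurable_funB.
    exact: measurableT_comp measurable_gap measurable_fst.
  apply: measurable_funM => //; apply: measurable_dot => i.
    exact: measurableT_comp (measurable_total_grad i) measurable_fst.
  exact: measurable_estimator.
by apply: measurable_funM => //; apply: measurable_sqr_norm2; exact: measurable_estimator.
Qed.

Let Q := (L + M) * A / beta ^+ 2.
Let c := (L + M) * C / (2 * beta ^+ 2).

Lemma growth_ge0 : 0 <= Q.
Proof. exact: divr_ge0 (mulr_ge0 (ltW LM_gt0) constA_ge0) (sqr_ge0 _). Qed.

Lemma noise_ge0 : 0 <= c.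
Proof.
apply: divr_ge0 (mulr_ge0 (ltW LM_gt0) constC_ge0) _.
by rewrite mulr_ge0 ?sqr_ge0.
Qed.

(** By unbiasedness the linear term of the model averages to
    [- beta^-1 * norm2 (total_grad y x) ^+ 2], which cancels the added term exactly; second moments
    bound the quadratic term. *)
Lemma expected_gap_model y x :
  (\int[D]_s (gap_model M beta y x (estimator y x s))%:E
    + (beta^-1 * norm2 (total_grad y x) ^+ 2)%:E <= ((1 + Q) * gap y x + c)%:E)%E.
Proof.
have b0 := beta_gt0; have LM0 := ltW LM_gt0.
have mZ i : measurable_fun setT (fun s => g y s 0 i).
  apply: (measurableT_comp (@coord_borel R n i)).
  exact: (measurableT_comp mg (pair1_measurable (y : bV))).
have EZ i : (\int[D]_s (g y s 0 i)%:E = (grad G y 0 i)%:E)%E.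
  by rewrite -gE unlock.
have := gS => -[_ _ _ /(_ y)]; rewrite unlock => EZ2.
pose k := (L + M) / (2 * beta ^+ 2).
have k0 : 0 <= k by apply: divr_ge0 LM0 _; rewrite mulr_ge0 ?sqr_ge0.
pose h := grady H x y; pose t := total_grad y x.
pose K := 2 * A0 * (G y - inf (range G)) + B0 * norm2 (grad G y) ^+ 2 + C0.
pose c' := gap y x - beta^-1 * dot t h + 2 * k * norm2 h ^+ 2.
have le_model s : gap_model M beta y x (estimator y x s) <=
    c' + dot (- beta^-1 *: t) (g y s) + 2 * k * norm2 (g y s) ^+ 2.
  have := ler_wpM2l k0 (sqr_norm2D_le (g y s) h).
  rewrite /gap_model -/k -/t /c' /estimator -/h dotZl dotDr; lra.
have mE : measurable_fun setT (fun s => gap_model M beta y x (estimator y x s)).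
  exact: (measurableT_comp (measurable_gap_model M) (pair1_measurable ((x, y) : bV * bV))).
have le_int : (\int[D]_s (gap_model M beta y x (estimator y x s))%:E <=
    (c' + dot (- beta^-1 *: t) (grad G y) + 2 * k * K)%:E)%E.
  apply: le_trans; last by apply: integral_quadratic_le mZ EZ EZ2 _; rewrite mulr_ge0.
  apply: ge0_le_lower_integral => s; rewrite lee_fin ?gap_model_ge0//.
apply: le_trans (leeD2r _ le_int) _; rewrite -EFinD lee_fin.
have := ler_wpM2l k0 (second_moment_le y x); rewrite -/K -/h.
have -> : Q = 2 * k * A by rewrite /Q /k; field; exact: lt0r_neq0.
have -> : c = k * C by rewrite /c /k mulrAC.
have -> : norm2 t ^+ 2 = dot t (grad G y) + dot t h by rewrite sqr_norm2 -dotDr.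
rewrite /c' dotZl; lra.
Qed.

(** * Random iterates and the averaged recursion *)

Section Run.
Context {T : nat} {d : measure_display} {Omega : measurableType d}.
Context {P : probability Omega R} {xi : nat -> Omega -> Xi}.
Context {y x u z : nat -> Omega -> V}.
Context (run : stam_run F H D g gamma beta T P xi y x u z).

Lemma run_point t w : (t <= T)%N ->
  exists zp, xuz_update F H gamma (y t w) zp (x t w) (u t w) (z t w).
Proof.
case: run => _ _ _ pt0 step; case: t => [|t] tT; first exact: pt0.
by have [_ pt] := step t tT w; exists (z t w).
Qed.

Lemma run_step t w : (t < T)%N ->
  xuz_update F H gamma (y t.+1 w) (z t w) (x t.+1 w) (u t.+1 w) (z t.+1 w) /\
  y t.+1 w = y t w - beta^-1 *: estimator (y t w) (x t w) (xi t w).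
Proof.
case: run => _ _ _ _ step tT; have [yu pt] := step t tT w.
by split=> //; exact: y_updateE beta_gt0 yu.
Qed.

Lemma measurable_run t :
  [/\ measurable_fun setT (y t : Omega -> bV), measurable_fun setT (x t : Omega -> bV),
      measurable_fun setT (u t : Omega -> bV) & measurable_fun setT (z t : Omega -> bV)].
Proof. by case: run. Qed.

Lemma measurable_run_coord t i :
  [/\ measurable_fun setT (fun w => x t w 0 i), measurable_fun setT (fun w => u t w 0 i)
    & measurable_fun setT (fun w => z t w 0 i)].
Proof.
have [_ mx mu mz] := measurable_run t.
by split; apply: (measurableT_comp (@coord_borel R n i)).
Qed.

(** The history is generated by events of single iterates, while the sample must be independent of
    the pair [(x t, y t)]. Sets whose preimage lies in the history form a sigma-algebra containing
    the rectangles. *)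
Lemma run_history t (B : set (bV * bV)) : measurable B ->
  history y x u z t ((fun w => (x t w, y t w)) @^-1` B).
Proof.
rewrite /history; set E := \bigcup_(_ in _) _.
have sE : sigma_algebra setT <<s E >> by exact: smallest_sigma_algebra.
have := sigma_algebra_image (fun w => (x t w, y t w) : bV * bV) sE.
move=> /smallest_sub sub mB; rewrite -[X in <<s E >> X]setTI.
move: B mB; rewrite measurable_prod_measurableType; apply: sub.
move=> _ [B1 mB1] [B2 mB2 <-]; rewrite /image_set_system /= setTI.
pose mE := @measurableI _ (g_sigma_algebraType E).
apply: (mE (x t @^-1` B1) (y t @^-1` B2)); apply: sub_sigma_algebra;
  exists t => //=.
  by left; left; right; exists B1 => //; rewrite setTI.
by left; left; left; exists B2 => //; rewrite setTI.
Qed.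

Lemma measurable_run_pair t :
  measurable_fun setT (fun w => (x t w, y t w) : bV * bV).
Proof.
by have [my mx _ _] := measurable_run t; exact: measurable_fun_pair.
Qed.

Let model (p : (bV * bV) * Xi) := (gap_model M beta (p.1.2 : V) (p.1.1 : V)
  (estimator (p.1.2 : V) (p.1.1 : V) p.2))%:E.

Let model_ge0 p : (0 <= model p)%E.
Proof. by rewrite lee_fin gap_model_ge0. Qed.

Let measurable_model : measurable_fun setT model.
Proof. by apply/measurable_EFinP; exact: measurable_gap_model. Qed.

Lemma integral_run t : (t < T)%N ->
  (\int[P]_w model ((x t w, y t w), xi t w) =
   \int[P]_w \int[D]_s model ((x t w, y t w), s))%E.
Proof.
case: run => _ /(_ t)[mxi law] ind _ _ tT.
apply: (integral_indep (measurable_run_pair t) mxi) => // B B' mB mB'.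
by rewrite -law//; apply: ind => //; exact: run_history.
Qed.

Lemma measurable_gap_run t : measurable_fun setT (fun w => gap (y t w) (x t w)).
Proof. exact: measurableT_comp measurable_gap (measurable_run_pair t). Qed.

Lemma measurable_sqr_total_grad_run t :
  measurable_fun setT (fun w => norm2 (total_grad (y t w) (x t w)) ^+ 2).
Proof.
apply: measurable_sqr_norm2 => i.
exact: measurableT_comp (measurable_total_grad i) (measurable_run_pair t).
Qed.

Lemma measurable_residual_run t :
  measurable_fun setT (fun w => residual (y t w) (x t w) (u t w)).
Proof.
have [my _ mu _] := measurable_run t.
apply: measurable_funD.
  apply: measurable_sqr_norm2 => i.
  exact: measurableT_comp (measurable_total_grad i) (measurable_fun_pair mu my).
under eq_fun do rewrite exprMn; apply: measurable_funM => //.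
apply: measurable_sqr_norm2 => i; under eq_fun do rewrite !mxE.
by have [mx mu' _] := measurable_run_coord t i; exact: measurable_funB.
Qed.

Definition merit_run t w : \bar R := merit F gamma (x t w) (u t w) (z t w).

Definition merit_excess t w : \bar R :=
  (merit_run t w - ereal_inf (range (merit_run ^~ w)))%E.

Lemma merit_excess_ge0 t w : (t <= T)%N -> (0 <= merit_excess t w)%E.
Proof.
move=> tT; have [zp pt] := run_point w tT.
have : (ereal_inf (range (merit_run ^~ w)) <= merit_run t w)%E.
  by apply: ereal_inf_lbound; exists t.
rewrite /merit_excess /merit_run (merit_fineE _ _ (F_fin_num pt)).
(* The infimum runs over all times and may be [-oo], which makes the excess [+oo]. *)
case: ereal_inf => [r| |] //=.
  by rewrite lee_fin -EFinB lee_fin subr_ge0.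
by rewrite addey// leey.
Qed.

Context (lF : lower_semicontinuous F).

Lemma measurable_merit_run t : measurable_fun setT (merit_run t).
Proof.
have [_ _ mu _] := measurable_run t.
apply: emeasurable_funD; first exact: measurableT_comp (lsc_borel lF) mu.
apply/measurable_EFinP; apply: measurable_funB; [apply: measurable_funB|];
  apply: measurable_funM => //; apply: measurable_sqr_norm2 => i;
  have [mx' mu' mz'] := measurable_run_coord t i; under eq_fun do rewrite !mxE.
- by do 2!apply: measurable_funB => //; apply: measurable_funM.
- exact: measurable_funB.
- exact: measurable_funB.
Qed.

Lemma measurable_merit_excess t : measurable_fun setT (merit_excess t).
Proof.
apply: emeasurable_funB; first exact: measurable_merit_run.
have := measurable_fun_einfs measurable_merit_run 0.
congr measurable_fun; apply/funext => w; rewrite /einfs /=; congr ereal_inf.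
by apply/seteqP; split=> [_ [k _ <-]|_ [k _ <-]]; exists k.
Qed.

(** Both excesses subtract the same infimum, so this reduces to [potential_step]; if the infimum is
    [-oo], both sides are [+oo]. *)
Lemma pathwise_recursion t w : (t < T)%N ->
  ((gap (y t.+1 w) (x t.+1 w))%:E + merit_excess t.+1 w
    + (residual (y t w) (x t w) (u t w) / (2 * beta))%:E <=
   (gap_model M beta (y t w) (x t w) (estimator (y t w) (x t w) (xi t w)))%:E
    + (beta^-1 * norm2 (total_grad (y t w) (x t w)) ^+ 2)%:E
    + merit_excess t w)%E.
Proof.
move=> tT; have [zp pt] := run_point w (ltnW tT).
have [pt' yE] := run_step w tT.
have := potential_step pt pt' yE.
have : (ereal_inf (range (merit_run ^~ w)) <= merit_run t w)%E.
  by apply: ereal_inf_lbound; exists t.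
rewrite /merit_excess /merit_run.
rewrite (merit_fineE _ _ (F_fin_num pt)) (merit_fineE _ _ (F_fin_num pt')).
case: ereal_inf => [r| |] //= _ h.
by rewrite -!EFinB -!EFinD lee_fin; move: h; lra.
Qed.

Lemma expected_recursion t : (t < T)%N ->
  (\int[P]_w (gap (y t.+1 w) (x t.+1 w))%:E + \int[P]_w merit_excess t.+1 w
    + ((2 * beta)^-1)%:E * \int[P]_w (residual (y t w) (x t w) (u t w))%:E <=
   (1 + Q)%:E * (\int[P]_w (gap (y t w) (x t w))%:E + \int[P]_w merit_excess t w)
    + c%:E)%E.
Proof.
move=> tT; have b0 := beta_gt0; have Q0 := growth_ge0; have c0 := noise_ge0.
have b20 : 0 <= (2 * beta)^-1 by rewrite invr_ge0 mulr_ge0// ltW.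
pose grad2 w := (beta^-1 * norm2 (total_grad (y t w) (x t w)) ^+ 2)%:E.
have gap0 s w : (0 <= (gap (y s w) (x s w))%:E)%E by rewrite lee_fin gap_ge0.
have mgap s : measurable_fun setT (fun w => (gap (y s w) (x s w))%:E).
  by apply/measurable_EFinP; exact: measurable_gap_run.
have mres : measurable_fun setT (fun w => (residual (y t w) (x t w) (u t w))%:E).
  by apply/measurable_EFinP; exact: measurable_residual_run.
have res0 w : (0 <= (residual (y t w) (x t w) (u t w))%:E)%E.
  by rewrite lee_fin addr_ge0 ?sqr_ge0.
have mgrad : measurable_fun setT grad2.
  apply/measurable_EFinP; apply: measurable_funM => //.
  exact: measurable_sqr_total_grad_run.
have grad0 w : (0 <= grad2 w)%E.
  by rewrite lee_fin mulr_ge0 ?sqr_ge0// invr_ge0 ltW.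
have N0 w : (0 <= merit_excess t w)%E by apply: merit_excess_ge0; exact: ltnW.
have N1 w : (0 <= merit_excess t.+1 w)%E by exact: merit_excess_ge0.
have mN := measurable_merit_excess.
have mxi : measurable_fun setT (xi t) by case: run => _ /(_ t)[].
have mstep : measurable_fun setT (fun w => model ((x t w, y t w), xi t w)).
  exact: measurableT_comp measurable_model
    (measurable_fun_pair (measurable_run_pair t) mxi).
have mmean : measurable_fun setT (fun w => \int[D]_s model ((x t w, y t w), s))%E.
  exact: measurableT_comp
    (measurable_fun_fubini_tonelli_F model measurable_model model_ge0)
    (measurable_run_pair t).
rewrite -(ge0_integralZl P measurableT mres)//.
rewrite -(ge0_integralD3 P (gap0 t.+1) N1 _ (mgap t.+1) (mN t.+1))//; last 2 first.
- by move=> w; exact: mule_ge0.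
- exact: measurable_funeM.
apply: (@le_trans _ _ (\int[P]_w (model ((x t w, y t w), xi t w) + grad2 w
                                  + merit_excess t w))%E).
  apply: ge0_le_lower_integral => w.
    by apply: adde_ge0; [exact: adde_ge0|exact: mule_ge0].
  by have := pathwise_recursion w tT; rewrite mulrC EFinM.
rewrite ge0_integralD3// integral_run//.
rewrite muleDr ?ge0_adde_def ?inE ?integral_ge0// [leRHS]addeAC.
(* The excess has coefficient 1; it is enlarged to [1 + Q] so that gap and excess share one growth
   factor. *)
apply: leeD; last first.
  rewrite -[leLHS]mul1e; apply: lee_wpmul2r; first exact: integral_ge0.
  by rewrite lee_fin lerDl.
rewrite -ge0_integralD//; last by move=> w _; exact: integral_ge0.
apply: (@le_trans _ _ (\int[P]_w ((1 + Q)%:E * (gap (y t w) (x t w))%:E + c%:E))%E).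
  apply: ge0_le_lower_integral => w; last by rewrite -EFinM -EFinD; exact: expected_gap_model.
  by rewrite adde_ge0// integral_ge0.
rewrite ge0_integralD//; last 2 first.
- by move=> w _; rewrite mule_ge0// lee_fin addr_ge0.
- exact: measurable_funeM.
rewrite ge0_integralZl ?lee_fin ?addr_ge0//.
apply: leeD => //; rewrite integral_cst//.
by have := lexx c%:E; rewrite -{1}(mule1 c%:E) -(probability_setT P).
Qed.

Let k1 := K1 l L2s gamma.
Let k2 := K2 L2s gamma.

Lemma exists_small_residual (eps : R) : 0 < eps -> (0 < T)%N ->
  let thr := beta_threshold k1 k2 L M A C eps T in
  thr < beta <= 103 / 100 * thr ->
  (T_threshold k1 k2 L M A C eps
     (delta P G H y x 0 + merit_gap P F gamma x u z) <= T%:R%:E)%E ->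
  exists2 t0, (t0 < T)%N &
    (\int[P]_w (residual (y t0 w) (x t0 w) (u t0 w))%:E <= (eps ^+ 2)%:E)%E.
Proof.
move=> e0 T0 thr /andP[thrb bthr].
pose S t := (\int[P]_w (gap (y t w) (x t w))%:E + \int[P]_w merit_excess t w)%E.
have <- : S 0%N = (delta P G H y x 0 + merit_gap P F gamma x u z)%E.
  by rewrite /S /delta unlock.
have S_ge0 t : (t <= T)%N -> (0 <= S t)%E.
  move=> tT; apply: adde_ge0; apply: integral_ge0 => w _.
    by rewrite lee_fin gap_ge0.
  exact: merit_excess_ge0.
have b0 := beta_gt0; have LM0 := LM_gt0; have A_ge0 := constA_ge0.
have e20 : 0 < eps ^+ 2 by rewrite exprn_gt0.
have k20 : 0 < k2 by apply: K2_gt0 => //; exact: L2s_ge0.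
move=> thrT; have [v [S0 v0 vT]] : exists v, [/\ S 0%N = v%:E, 0 <= v &
    12 * v * thr <= T%:R * eps ^+ 2].
  (* An infinite initial potential would make the threshold infinite, because the last entry of its
     maximum is positive. *)
  move: thrT (S_ge0 0%N isT); case: (S 0%N) => [v| |]//.
    rewrite /T_threshold -!EFinM -!EFin_max -EFinM !lee_fin => vT v0.
    exists v; split=> //; rewrite /thr /beta_threshold.
    by apply: threshold_le vT.
  rewrite /T_threshold gt0_muley; last first.
    by rewrite lte_fin divr_gt0// mulr_gt0.
  rewrite gt0_mulye ?leye_eq//.
  rewrite lt_max; apply/orP; right.
  by rewrite lte_fin; apply: divr_gt0; apply: mulr_gt0.
have bQ : Q * T%:R <= 1.
  rewrite /Q mulrAC ler_pdivrMr ?exprn_gt0// mul1r.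
  have LMAT : 0 <= (L + M) * A * T%:R.
    by apply: mulr_ge0 => //; apply: mulr_ge0 => //; exact: ltW.
  rewrite -(sqr_sqrtr LMAT) ler_pXn2r ?nnegrE ?sqrtr_ge0 ?(ltW b0)//.
  by apply: le_trans (ltW thrb); rewrite /thr /beta_threshold !le_max lexx.
have bC : c <= (2 * beta)^-1 * eps ^+ 2 / 2.
  have : 2 * (L + M) * C / eps ^+ 2 <= beta.
    by apply: le_trans (ltW thrb); rewrite /thr /beta_threshold !le_max lexx orbT.
  rewrite ler_pdivrMr// => LMC.
  rewrite /c ler_pdivrMr ?mulr_gt0 ?exprn_gt0//.
  have -> : (2 * beta)^-1 * eps ^+ 2 / 2 * (2 * beta ^+ 2) = beta * eps ^+ 2 / 2.
    by field; exact: lt0r_neq0.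
  by lra.
apply: (small_term_of_recursion growth_ge0 _ (ltW e20) bC (S_ge0 T (leqnn T))).
- by rewrite invr_gt0 mulr_gt0.
- by rewrite S0.
- by move=> t tT; exact: expected_recursion.
rewrite S0 /=.
have -> : T%:R * ((2 * beta)^-1 * eps ^+ 2 / 2) = T%:R * eps ^+ 2 / (4 * beta).
  by field; exact: lt0r_neq0.
rewrite ltr_pdivlMr ?mulr_gt0//.
have T1 : 0 < T%:R * eps ^+ 2 by rewrite mulr_gt0// ltr0n.
have p1 := exprD1n_le growth_ge0 bQ.
(* [4 * (8/7)^8 * 103/100] is just below 12, which explains the factor 103/100; [T eps^2 > 0] makes
   the final inequality strict. *)
have : (1 + Q) ^+ T * v * (4 * beta) <= (8 / 7) ^+ 8 * v * (4 * (103 / 100 * thr)).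
  by apply: ler_pM => //; rewrite ?mulr_ge0 ?exprn_ge0 ?addr_ge0 ?growth_ge0
    ?(ltW b0)// ?ler_wpM2r ?ler_pM2l.
move: vT T1; move: (T%:R * eps ^+ 2) => r; lra.
Qed.

Lemma residual_bounds (eps : R) t : 0 < eps -> (t < T)%N ->
  (\int[P]_w (residual (y t w) (x t w) (u t w))%:E <= (eps ^+ 2)%:E)%E ->
  ('E_P[fun w => norm2 (grad G (y t w) + grady H (u t w) (y t w))%R] <= eps%:E)%E /\
  (\int[P]_w dist0 [set (gradx H (u t w) (y t w) + s)%R
                    | s in limiting_subdiff F (u t w)] <= eps%:E)%E.
Proof.
move=> e0 tT res; split.
  rewrite unlock.
  apply: (lower_integral_le_sqrt
    (a := fun w => norm2 (total_grad (y t w) (u t w))) e0)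
    (measurable_residual_run t) res => w //.
    by rewrite lee_fin norm2_ge0.
  by rewrite lerDl sqr_ge0.
apply: (lower_integral_le_sqrt
  (a := fun w => (gamma^-1 + L2s) * norm2 (u t w - x t w)) e0)
  (measurable_residual_run t) res => w.
- exact: dist0_ge0.
- by have [zp pt] := run_point w (ltnW tT); exact: dist0_residual pt.
- by rewrite lerDr sqr_ge0.
Qed.

End Run.
End Stochastic.
End Potential.
End Pathwise.

Theorem theorem11 (R : realType) (n : nat)
  (F : 'rV[R]_n -> \bar R) (G : 'rV[R]_n -> R) (H : 'rV[R]_n -> 'rV[R]_n -> R)
  (L1 : R) (L2 L3 L4 L5 : 'rV[R]_n -> R) (L2s L3s L4s L5s L l : R)
  (dXi : measure_display) (Xi : measurableType dXi) (D : probability Xi R)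
  (g : 'rV[R]_n -> Xi -> 'rV[R]_n) (A0 B0 C0 : R)
  (gamma eps : R) (T : nat)
  (k1 := K1 l L2s gamma) (k2 := K2 L2s gamma) (M := constM l L2s L4s gamma)
  (A := constA A0 B0 L1 L3s) (C := constC G H A C0) :
  proper F -> lower_semicontinuous F ->
  lower_semicontinuous (fun y => (G y)%:E) ->
  lower_semicontinuous (fun p : 'rV[R]_n * 'rV[R]_n => (H p.1 p.2)%:E) ->
  has_lbound (range (fun p : 'rV[R]_n * 'rV[R]_n => H p.1 p.2)) ->
  assumption_a1 G L1 ->
  assumption_a2 H L2 L3 L4 L5 ->
  assumption_a3 H L1 L2 L3 L4 L5 L2s L3s L4s L5s L l ->
  measurable_fun setT
    (fun p : borel_rV R n * Xi => (g p.1 p.2 : borel_rV R n)) ->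
  unbiased D G g ->
  expected_smoothness D G g A0 B0 C0 ->
  0 < gamma -> 0 < k1 -> (L2s ^+ 2 + L5s ^+ 2) * gamma ^+ 2 <= 1 ->
  0 < eps -> (0 < T)%N ->
  exists2 beta_max : R, beta_threshold k1 k2 L M A C eps T < beta_max &
  forall beta : R, beta_threshold k1 k2 L M A C eps T < beta <= beta_max ->
  forall (d : measure_display) (Omega : measurableType d)
    (P : probability Omega R) (xi : nat -> Omega -> Xi)
    (y x u z : nat -> Omega -> 'rV[R]_n),
  stam_run F H D g gamma beta T P xi y x u z ->
  (T_threshold k1 k2 L M A C eps
     (delta P G H y x 0 + merit_gap P F gamma x u z) <= T%:R%:E)%E ->
  exists2 t0 : nat, (t0 < T)%N &
    ('E_P[fun w => norm2 (grad G (y t0 w) + grady H (u t0 w) (y t0 w))%R]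
       <= eps%:E)%E /\
    (\int[P]_w dist0 [set (gradx H (u t0 w) (y t0 w) + s)%R
                      | s in limiting_subdiff F (u t0 w)] <= eps%:E)%E.
Proof.
move=> Fp lF _ _ Hlb a1 a2 a3 mg gE gS gamma0 k10 gammaL e0 T0.
set thr := beta_threshold _ _ _ _ _ _ _ _.
have thrK : 2 * k2 / k1 <= thr by rewrite /thr /beta_threshold !le_max lexx orbT.
(* Positivity puts [103 / 100 * thr] strictly above the threshold. *)
have thr0 : 0 < thr.
  apply: lt_le_trans thrK; apply: divr_gt0 k10; apply: mulr_gt0 => //.
  by apply: K2_gt0 => //; case: a3 => -[].
exists (103 / 100 * thr); first by lra.
move=> beta thrb d Omega P xi y x u z run thrT.
have betaK : 2 * k2 / k1 < beta by case/andP: thrb => + _; exact: le_lt_trans.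
have [t0 tT res] := exists_small_residual Fp Hlb a1 a2 a3 gamma0 k10 gammaL betaK
  mg gE gS run lF e0 T0 thrb thrT.
exists t0 => //.
by have := residual_bounds Fp a1 a2 a3 gamma0 run e0 tT res.
Qed.
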